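(* Let $d\ge 1$ and let $K$ be a finite pure ridge-connected $d$-dimensional simplicial complex with at least two facets. Every eigenvalue $\lambda>0$ of the upper Laplacian $L^{\mathrm{up}}_{d-1}(K)$ with $\lambda\ne d$ satisfies \[ m_K(\lambda)\le 2\theta_d(K)+q_d(K). \qquad (\ast) \] If $K$ is neither a ridge-star nor a complex satisfying $(\theta_d(K),p_d(K))=(1,0)$, then every eigenvalue $\lambda>0$ of $L^{\mathrm{up}}_{d-1}(K)$ with $\lambda\neq d$ satisfies \[ m_K(\lambda)\le 2\theta_d(K)+q_d(K)-1. \] Moreover, the following are equivalent: (i) equality in $(\ast)$ is attained by some positive eigenvalue $\lambda\ne d$ of $L^{\mathrm{up}}_{d-1}(K)$; (ii) $K$ is either a ridge-star or a simplicial cycle.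
   Context: A finite abstract simplicial complex $K$ is a collection of subsets (faces) of a finite vertex set closed under taking subsets; a face $\sigma$ has dimension $|\sigma|-1$. $K_i$ is the set of $i$-dimensional faces and $f_i(K)=|K_i|$. Facets are inclusion-maximal faces; $K$ is pure of dimension $d$ if every facet has dimension $d$. A ridge is a $(d-1)$-face. $K$ is ridge-connected if for every two facets $F,F'$ there are facets $F=F_0,F_1,\ldots,F_t=F'$ such that $F_{i-1}$ and $F_i$ share a ridge for each $i$. Choose an orientation of every face; $C_i(K;\mathbb{R})$ is the real vector space with the oriented $i$-faces as orthonormal basis, and $\partial_i:C_i(K;\mathbb{R})\to C_{i-1}(K;\mathbb{R})$, $\partial_i[v_0,\ldots,v_i]=\sum_{j=0}^i(-1)^j[v_0,\ldots,\widehat{v_j},\ldots,v_i]$, is the boundary operator, identified with its matrix. The upper Laplacian on ridges is $L_{d-1}^{\mathrm{up}}(K)=\partial_d\partial_d^{\mathsf T}$ (its spectrum does not depend on the orientations). For $\lambda>0$, $m_K(\lambda)$ is the multiplicity of $\lambda$ as an eigenvalue of $L_{d-1}^{\mathrm{up}}(K)$. A ridge is free if it is contained in exactly one facet, otherwise nonfree. A facet is pendant if exactly $d$ of its $d+1$ ridges are free; $p_d(K)$ is the number of pendant facets. A nonfree ridge is quasi-pendant if it is contained in at least one pendant facet; $q_d(K)$ is the number of quasi-pendant ridges. Define $\theta_d(K)=d f_d(K)-f_{d-1}(K)+1$. A pure ridge-connected $d$-complex $K$ is a simplicial cycle if its facets can be cyclically ordered as $F_1,\ldots,F_m$ with $m\ge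 3$, and there are distinct ridges $R_1,\ldots,R_m$ such that, with indices modulo $m$: (1) $R_i=F_i\cap F_{i+1}$; (2) $R_i$ is contained in exactly the two facets $F_i$ and $F_{i+1}$; (3) $R_1,\ldots,R_m$ are all the nonfree ridges of $K$. A pure ridge-connected $d$-dimensional complex $K$ with at least two facets is a ridge-star if there is a ridge $R$ contained in every facet and every ridge other than $R$ is free. *)

(* Defs.v *)
From mathcomp Require Import all_boot all_order all_algebra reals.
Set Implicit Arguments.
Unset Strict Implicit.
Unset Printing Implicit Defensive.
Import Order.TTheory GRing.Theory Num.Theory.
Local Open Scope ring_scope.

Section Complexes.
Variable T : finType.
Implicit Types (K : {set {set T}}) (d : nat) (o : {set T} -> seq T).

(* The empty face (of dimension -1) belongs to every nonempty complex. *)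
Definition simplicial_complex K : Prop :=
  forall s t : {set T}, s \in K -> t \subset s -> t \in K.

Definition faces K (i : nat) : {set {set T}} := [set s in K | #|s| == i.+1].

Definition facets K : {set {set T}} := [set F | maxset [in K] F].

Definition pure K d : Prop := forall F, F \in facets K -> #|F| = d.+1.

(* Only meaningful for d >= 1. *)
Definition ridges K d : {set {set T}} := faces K d.-1.

Definition share_ridge K d : rel {set T} :=
  [rel F G | [&& F \in facets K, G \in facets K &
     [exists R in ridges K d, (R \subset F) && (R \subset G)]]].

Definition ridge_connected K d : Prop :=
  forall F G, F \in facets K -> G \in facets K -> connect (share_ridge K d) F G.

Definition facets_at K (R : {set T}) : {set {set T}} :=
  [set F in facets K | R \subset F].

Definition free_ridges K d : {set {set T}} :=
  [set R in ridges K d | #|facets_at K R| == 1%N].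

Definition nonfree_ridges K d : {set {set T}} := ridges K d :\: free_ridges K d.

Definition pendant_facets K d : {set {set T}} :=
  [set F in facets K | #|[set R in free_ridges K d | R \subset F]| == d].

Definition quasi_pendant_ridges K d : {set {set T}} :=
  [set R in nonfree_ridges K d | [exists F in pendant_facets K d, R \subset F]].

Definition theta K d : int :=
  d%:Z * #|faces K d|%:Z - #|ridges K d|%:Z + 1.

(* ordS is the cyclic successor on 'I_m. *)
Definition simplicial_cycle K d : Prop :=
  [/\ pure K d, ridge_connected K d &
   exists m : nat, exists F : 'I_m -> {set T}, exists R : 'I_m -> {set T},
   [/\ (3 <= m)%N,
       injective F /\ [set F i | i : 'I_m] = facets K,
       injective R /\ (forall i, R i \in ridges K d) &
   [/\ forall i, R i = F i :&: F (ordS i),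
       forall i, facets_at K (R i) = [set F i; F (ordS i)] &
       [set R i | i : 'I_m] = nonfree_ridges K d]]].

Definition ridge_star K d : Prop :=
  [/\ pure K d, ridge_connected K d, (2 <= #|facets K|)%N &
   exists2 R : {set T}, R \in ridges K d &
     (forall F, F \in facets K -> R \subset F) /\
     (forall R', R' \in ridges K d -> R' != R -> R' \in free_ridges K d)].

(* A choice of orientations: every face s is oriented by the ordering o s of
   its vertices. *)
Definition orientation K o : Prop :=
  forall s, s \in K -> perm_eq (o s) (enum s).

(* The number of inversions of the rearrangement taking t to s. *)
Definition inversions (s t : seq T) : nat :=
  #|[set ab : T * T | [&& ab.1 \in s, ab.2 \in s,
       (index ab.1 s < index ab.2 s)%N & (index ab.2 t < index ab.1 t)%N]]|.

(* The coefficient of the basis element [o t] in the oriented simplex [w]: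
   the sign of the permutation relating the two orderings if the vertices of w
   are those of t, and 0 otherwise. *)
Definition simplex_coef (R : pzRingType) o (w : seq T) (t : {set T}) : R :=
  if perm_eq w (o t) then (-1) ^+ inversions w (o t) else 0.

(* The matrix of the boundary operator C_i -> C_(i-1), for i >= 1: the entry
   (t, s) is the coefficient of t in the sum of the (-1)^j times the oriented
   simplices obtained by deleting the j-th vertex of s. *)
Definition boundary (R : pzRingType) o K (i : nat) :
    'M[R]_(#|faces K i.-1|, #|faces K i|) :=
  \matrix_(t, s) \sum_(j < i.+1)
    (-1) ^+ j * simplex_coef R o
      (take j (o (enum_val s)) ++ drop j.+1 (o (enum_val s))) (enum_val t).

Definition ridge_laplacian (R : pzRingType) o K d : 'M[R]_#|faces K d.-1| :=
  boundary R o K d *m (boundary R o K d)^T.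

(* The matrix is symmetric, so that the space of row eigenvectors [eigenspace] is the
   usual eigenspace and its dimension is also the algebraic multiplicity. *)
Definition multiplicity (R : realType) o K d (lam : R) : nat :=
  \rank (eigenspace (ridge_laplacian R o K d) lam).

End Complexes.

(* Main.v *)
Require Import Defs.
From mathcomp Require Import all_boot all_order all_algebra reals.
From mathcomp Require Import zify ring lra.
From mathcomp Require trigo.
Set Implicit Arguments.
Unset Strict Implicit.
Unset Printing Implicit Defensive.
Import Order.TTheory GRing.Theory Num.Theory.
Local Open Scope ring_scope.

(** Let B be the bipartite graph whose vertices are the ridges and the facets
    of K, with an edge for every inclusion of a ridge in a facet.  A facet has
    d+1 ridges, so theta K d is the cyclomatic number of B.  The leaves of B
    are the free ridges; delete them, and then delete the pendant facets, which
    have become leaves.  What remains is the [core]: the nonfree ridges and the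
    nonpendant facets.  It is connected, it has the same cyclomatic number, and
    its own leaves are quasi-pendant ridges.

    Upper bounds.  Let x be an eigenvector for lam and y its coboundary on the
    facets: y = x D and lam x = y D^T, where D is the boundary matrix.  At every
    vertex this is a linear relation between the value there and the values at
    the neighbours in B, with coefficients +1 or -1 at the neighbours.  If lam
    is neither 0 nor d, the vanishing of y at a facet makes x vanish at the free
    ridges of that facet, and the vanishing of x at a ridge makes y vanish at
    the pendant facets around it.  Hence zeros spread in the core by the rule of
    zero forcing: a vertex with value 0 all of whose neighbours but one have
    value 0 forces value 0 at the last one ([vanishing_closed]).  If the zeros
    on a set S spread to the whole core, then the multiplicity of lam is at
    most the cardinality of S ([multiplicity_le]).

    A forcing set S is found by exploring the core from a vertex v0.  When a new
    vertex v is explored, one neighbour is known already, and it costs at most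
    deg v - 2 vertices to make all the unknown neighbours but one vanish
    ([forcing_from]).  The sum of deg v - 2 over the core is 2 (theta - 1), and
    each leaf adds 1 because its true cost is 0; this gives 2 theta + q, and one
    less if v0 is a leaf.  If there is no leaf, the number of leaves in the
    estimate is 0, and one vertex is gained as soon as q > 0.  If q = 0 as well
    and some degree exceeds 2, then some vertex w of degree at least 3 lies on a
    cycle; exploring the rest of the cycle before w makes two neighbours of w
    known in advance and saves one vertex ([forcing_branch]).  There remain the
    core with a single vertex, which means a ridge-star, and the core with all
    degrees 2, which means (theta, p) = (1, 0), and then K is a simplicial cycle
    ([unicyclic_cycle]).

    Sharpness.  For a ridge-star with n facets, the signs of the incidences with
    the central ridge form an eigenvector for d + n.  For a simplicial cycle
    with m facets, the matrix D^T D is d+1 plus the signed adjacency matrix of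
    a cycle of length m.  After a change of signs, the sequences cos (k phi) and
    sin (k phi) are eigenvectors for d + 1 + 2 cos phi, where phi = 2 pi / m if
    the product E of the signs around the cycle is 1, and phi = pi / m if E is
    -1.  Then cos phi >= 0, so the eigenvalue is positive and differs from d;
    the only exception would be m = 3 with E = 1, and it does not occur, since
    three facets in a cycle lie on the boundary of a simplex of dimension d+1,
    where E = -1 ([incidence_three_cycle]). *)

(** * Zero forcing in a finite graph *)

Section Forcing.
Local Open Scope nat_scope.
Variables (V : finType) (e : rel V).
Hypothesis e_sym : symmetric e.
Implicit Types (A B D S Z : {set V}) (u v w : V).

Definition nbrs v : {set V} := [set w | e v w].

Definition deg v : nat := #|nbrs v|.

(** The zero-forcing rule: a zero all of whose neighbours but one are zeros
    forces the last one.  Zero sets of eigenvectors obey it. *)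
Definition forcing_closed Z : Prop :=
  forall v w, v \in Z -> e v w ->
    (forall u, e v u -> u != w -> u \in Z) -> w \in Z.

(** The neighbours are included because a vertex counts as explored only when
    the zeros on [S] reach all of its neighbours. *)
Definition determines S D : Prop :=
  forall Z, S \subset Z -> forcing_closed Z ->
    forall v, v \in D -> v \in Z /\ nbrs v \subset Z.

(** Connectedness in the form that lets an exploration of [B] continue until
    it has reached all of [B]. *)
Definition connected_set B : Prop :=
  forall D u v, D \subset B -> u \in D -> v \in B -> v \notin D ->
    exists u' v', [/\ u' \in D, v' \in B, v' \notin D & e u' v'].

Lemma path_crossing a q D u v :
    path e a q -> u \in a :: q -> v \in a :: q -> u \in D -> v \notin D ->
  exists u' v', [/\ u' \in D, v' \in a :: q, v' \notin D & e u' v'].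
Proof.
elim: q a u v => [|b q IH] a u v.
  by move=> _; rewrite !inE => /eqP-> /eqP-> ->.
move=> /andP[eab pq] uin vin uD vD.
case aD: (a \in D); case bD: (b \in D).
- have v_in : v \in b :: q.
    by move: vin; rewrite inE => /orP[/eqP va|//]; rewrite va aD in vD.
  have [u' [v' [h1 h2 h3 h4]]] := IH b b v pq (mem_head _ _) v_in bD vD.
  by exists u', v'; split=> //; rewrite inE h2 orbT.
- exists a, b; split=> //; last by rewrite bD.
  by rewrite !inE eqxx orbT.
- exists b, a; split=> //; last by rewrite e_sym.
  + by rewrite mem_head.
  + by rewrite aD.
- have u_in : u \in b :: q.
    by move: uin; rewrite inE => /orP[/eqP ua|//]; rewrite ua aD in uD.
  have [u' [v' [h1 h2 h3 h4]]] :=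
    IH b u b pq u_in (mem_head _ _) uD (negbT bD).
  by exists u', v'; split=> //; rewrite inE h2 orbT.
Qed.

Lemma connected_path a q : path e a q -> connected_set [set x in a :: q].
Proof.
move=> pq D u v /subsetP DB uD vB vD.
have uB := DB _ uD; rewrite !inE in uB vB.
have [||u' [v' [h1 h2 h3 h4]]] := path_crossing pq _ _ uD vD.
- by rewrite inE.
- by rewrite inE.
by exists u', v'; split=> //; rewrite inE.
Qed.

Lemma connected_connect A :
    (forall u v, u \in A -> e u v -> v \in A) ->
    (forall u v, u \in A -> v \in A -> connect e u v) ->
  connected_set A.
Proof.
move=> clA conA D u v /subsetP DA uD vA vD.
have uA := DA _ uD.
have /connectP[p pp lp] := conA u v uA vA.
have qA : forall x, x \in u :: p -> x \in A.
  elim: p u uA {uD lp} pp => [|b p IH] u uA.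
    by move=> _ x; rewrite inE => /eqP->.
  move=> /andP[eub pp] x; rewrite inE => /orP[/eqP->//|].
  by apply: IH pp _; apply: clA eub.
have [|u' [v' [h1 h2 h3 h4]]] := path_crossing (v := v) pp (mem_head _ _) _ uD vD.
  by rewrite lp mem_last.
by exists u', v'; split=> //; apply: qA.
Qed.

(** All the neighbours of [v] but one are put in the set, and [v] forces the
    last one. *)
Lemma forcing_start v : exists2 S, determines S [set v] & #|S| <= 1 + (deg v).-1.
Proof.
have [N0|[w wN]] := set_0Vmem (nbrs v).
  exists [set v]; last by rewrite cards1.
  move=> Z SZ _ x; rewrite inE => /eqP->; rewrite N0 sub0set; split=> //.
  by rewrite -sub1set.
exists (v |: (nbrs v :\ w)).
  move=> Z /subsetP SZ clZ x; rewrite inE => /eqP->{x}.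
  have vZ : v \in Z by apply: SZ; rewrite !inE eqxx.
  have NZ u : e v u -> u != w -> u \in Z.
    by move=> evu uw; apply: SZ; rewrite !inE uw evu orbT.
  split=> //; apply/subsetP => u; rewrite inE => evu.
  have [uw|uw] := eqVneq u w; last exact: NZ.
  by rewrite uw; apply: clZ vZ _ NZ; rewrite inE in wN.
rewrite /deg (cardsD1 w (nbrs v)) wN /=.
by rewrite cardsU1 leq_add2r leq_b1.
Qed.

(** The explored set grows by a vertex [v] adjacent to it.  The neighbours of
    [v] in [D] are known already; all the others but one are added, and [v]
    forces the last one. *)
Lemma forcing_extend S D u v :
    determines S D -> u \in D -> e u v ->
  exists2 S', determines S' (v |: D)
    & #|S'| <= #|S| + (deg v - #|nbrs v :&: D|).-1.
Proof.
move=> SD uD euv; rewrite -cardsD.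
have known Z : S \subset Z -> forcing_closed Z ->
    (forall x, x \in v |: D -> nbrs v \subset Z -> x \in Z /\ nbrs x \subset Z).
  move=> SZ clZ x; rewrite !inE => /orP[/eqP->|xD] NZ; last exact: SD xD.
  split=> //; have [_ /subsetP uN] := SD Z SZ clZ u uD.
  by apply: uN; rewrite inE.
have [N0|[w wN]] := set_0Vmem (nbrs v :\: D).
  exists S; last by rewrite leq_addr.
  move=> Z SZ clZ x xD; apply: known => //.
  apply/subsetP => y yN; have : y \notin nbrs v :\: D by rewrite N0 inE.
  rewrite inE yN andbT negbK => yD.
  by have [] := SD Z SZ clZ y yD.
exists (S :|: ((nbrs v :\: D) :\ w)); last first.
  rewrite [X in _ <= _ + X.-1](cardsD1 w) wN /=.
  by rewrite (leq_trans (leq_card_setU _ _)).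
move=> Z; rewrite subUset => /andP[SZ /subsetP XZ] clZ x xD.
apply: known => //.
have vZ : v \in Z.
  by have [_ /subsetP uN] := SD Z SZ clZ u uD; apply: uN; rewrite inE.
have NZ y : e v y -> y != w -> y \in Z.
  move=> evy yw; have [yD|yD] := boolP (y \in D).
    by have [] := SD Z SZ clZ y yD.
  by apply: XZ; rewrite !inE yw yD evy.
apply/subsetP => y; rewrite inE => evy.
have [->|] := eqVneq y w; last exact: NZ.
by apply: clZ vZ _ NZ; move: wN; rewrite !inE => /andP[].
Qed.

(** Each new vertex has at least one explored neighbour, whence the cost
    [deg v - 2]; the truncated subtraction is right for a leaf, which is free. *)
Lemma forcing_grow S D B u0 :
    determines S D -> u0 \in D -> D \subset B -> connected_set B ->
  exists2 S', determines S' B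
    & #|S'| <= #|S| + \sum_(v in B :\: D) (deg v - 2).
Proof.
move=> SD u0D DB conB.
have [n] := ubnP #|B :\: D|.
elim: n S D SD u0D DB => // n IH S D SD u0D DB.
have [BD0|[v]] := set_0Vmem (B :\: D).
  have -> : B = D.
    by apply/eqP; rewrite eqEsubset DB -setD_eq0 BD0 eqxx.
  by exists S => //; rewrite leq_addr.
rewrite inE => /andP[vD vB] leBn.
have [u [w [uD wB wD euw]]] := conB D u0 v DB u0D vB vD.
have [S' S'D cS'] := forcing_extend SD uD euw.
have wBD : w \in B :\: D by rewrite inE wD.
have BDw : B :\: (w |: D) = (B :\: D) :\ w.
  by apply/setP => x; rewrite !inE; case: (x == w); case: (x \in D).
have [||| S'' S''B cS''] := IH S' (w |: D) S'D.
- by rewrite !inE u0D orbT.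
- by rewrite subUset sub1set wB.
- by move: leBn; rewrite BDw (cardsD1 w) wBD; lia.
exists S'' => //.
rewrite (big_setD1 w wBD) /= -BDw.
have : 0 < #|nbrs w :&: D|.
  by apply/card_gt0P; exists u; rewrite !inE uD e_sym euw.
by lia.
Qed.

Lemma forcing_from A v0 :
    connected_set A -> v0 \in A ->
  exists2 S, determines S A
    & #|S| <= 1 + (deg v0).-1 + \sum_(v in A :\ v0) (deg v - 2).
Proof.
move=> conA v0A.
have [S SD cS] := forcing_start v0.
have [|S' S'A cS'] := forcing_grow SD (set11 v0) _ conA.
  by rewrite sub1set.
by exists S' => //; apply: leq_trans cS' _; rewrite leq_add2r.
Qed.

(** The gain of one vertex: [B] is explored first, and then [w], which has two
    explored neighbours and hence costs [deg w - 3] only. *)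
Lemma forcing_detour A B v1 v2 w :
    connected_set A -> connected_set B -> B \subset A -> w \in A -> w \notin B ->
    v1 \in B -> v2 \in B -> v1 != v2 -> e w v1 -> e w v2 -> 2 < deg w ->
    2 <= deg v1 ->
  exists2 S, determines S A & #|S| <= 1 + \sum_(v in A) (deg v - 2).
Proof.
move=> conA conB BA wA wB v1B v2B v12 ew1 ew2 dw d1.
have [S SB cS] := forcing_from conB v1B.
have [S' S'B cS'] := forcing_extend SB v1B (etrans (e_sym _ _) ew1).
have wBA : w |: B \subset A by rewrite subUset sub1set wA.
have [|S'' S''A cS''] := forcing_grow (u0 := w) S'B _ wBA conA.
  by rewrite !inE eqxx.
exists S'' => //.
have : 2 <= #|nbrs w :&: B|.
  have <- : #|[set v1; v2]| = 2 by rewrite cards2 v12.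
  by apply: subset_leq_card; rewrite subUset !sub1set !inE ew1 ew2 v1B v2B.
rewrite (big_setID (w |: B)) /= (setIidPr wBA) big_setU1 //=.
rewrite (big_setD1 v1 v1B) /=; lia.
Qed.

(** The neighbours of an end [x] of a path that cannot be prolonged all lie on
    it; one of them that is not next to [x] closes a cycle. *)
Lemma cycle_exists A x0 :
    irreflexive e ->
    (forall u v, u \in A -> e u v -> v \in A) ->
    (forall v, v \in A -> 2 <= deg v) -> x0 \in A ->
  exists c, [/\ cycle e c, uniq c, 2 < size c & {subset c <= A}].
Proof.
move=> e_irr clA degA x0A.
have [N maxN] : exists N, forall s : seq V, uniq s -> size s <= N.
  by exists #|V| => s us; rewrite -(card_uniqP us) max_card.
suff H n x p : path e x p -> uniq (x :: p) -> {subset x :: p <= A} ->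
    N - size p <= n ->
    exists c, [/\ cycle e c, uniq c, 2 < size c & {subset c <= A}].
  by apply: (H N x0 [::]) => //; rewrite ?leq_subr // => x; rewrite inE => /eqP->.
elim: n x p => [|n IH] x p pp up sA lep.
  by have /= := maxN _ up; lia.
have xA : x \in A by apply: sA; rewrite mem_head.
have [/existsP[y /andP[exy yp]]|noext] := boolP [exists y, e x y && (y \notin x :: p)].
  apply: (IH y (x :: p)).
  - by rewrite /= e_sym exy.
  - by rewrite cons_uniq yp.
  - by move=> z; rewrite inE => /orP[/eqP->|/sA//]; apply: clA exy.
  - by have /= := maxN _ up; lia.
have inp y : e x y -> y \in p.
  move=> exy; apply: contraT => yp; case/negP: noext; apply/existsP; exists y.
  rewrite exy inE negb_or yp andbT.
  by apply: contraTneq exy => ->; rewrite e_irr.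
have [y exy yh] : exists2 y, e x y & y != head x p.
  have : 0 < #|nbrs x :\ head x p|.
    by have := degA x xA; rewrite /deg (cardsD1 (head x p)); case: (_ \in _); lia.
  by case/card_gt0P => y; rewrite !inE => /andP[yh exy]; exists y.
have yp := inp y exy.
case/splitPr: yp pp up sA yh {lep noext inp} => p1 p2 pp up sA yh.
exists (x :: rcons p1 y); split.
- move: pp; rewrite cat_path /= => /and3P[pp1 epy _].
  by rewrite !rcons_path pp1 epy last_rcons e_sym exy.
- move: up; rewrite -cat_rcons -cat_cons cat_uniq; by case/andP.
- by rewrite /= size_rcons; case: p1 yh {pp up sA} => //=; rewrite eqxx.
- move=> z zc; apply: sA; rewrite -cat_rcons -cat_cons mem_cat zc; by [].
Qed.

Lemma cycle_nbrs c w :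
    cycle e c -> uniq c -> 2 < size c -> w \in c ->
  exists a q, [/\ path e a q, e w a, e w (last a q), a != last a q &
    w \notin a :: q /\ c =i w :: a :: q].
Proof.
move=> cc uc sc wc.
have [i s rs] := rot_to wc.
move: cc uc sc; rewrite -(rot_cycle i) -(rot_uniq i) -(size_rot i) rs.
case: s rs => [|a q] rs //= /andP[ewa]; rewrite rcons_path => /andP[paq ela].
move=> /and3P[wn an uq] sq; exists a, q; split=> //.
- by rewrite e_sym.
- by case: q an {rs paq ela wn uq} sq => //= b q an _; apply: contraNneq an => ->; apply: mem_last.
- by split=> // x; rewrite -rs mem_rot.
Qed.

(** A cycle none of whose vertices has a further neighbour is a connected
    component. *)
Lemma cycle_branch_or_all A c :
    connected_set A -> {subset c <= A} -> cycle e c -> uniq c -> 2 < size c ->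
  (exists2 w, w \in c & 2 < deg w) \/ A = [set x in c].
Proof.
move=> conA cA cc uc sc.
have [/hasP[w wc dw]|/hasPn noh] := boolP (has (fun w => 2 < deg w) c).
  by left; exists w.
right; apply/esym/eqP; rewrite eqEsubset; apply/andP; split.
  by apply/subsetP => x; rewrite inE => /cA.
apply/subsetP => v vA; apply: contraT => vc.
have [x xc] : exists x, x \in [set x in c].
  by case: c {cA cc uc noh vc} sc => // x s _; exists x; rewrite inE mem_head.
have [|u' [v' [u'c v'A v'c euv]]] := conA _ _ _ _ xc vA vc.
  by apply/subsetP => y; rewrite inE => /cA.
rewrite inE in u'c.
have [a [q [paq ewa ewl al [wn ceq]]]] := cycle_nbrs cc uc sc u'c.
have := noh _ u'c; rewrite -leqNgt /deg.
suff : 2 < #|nbrs u'| by rewrite ltnNge => /negP.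
have v'q : v' \notin a :: q.
  by apply: contraNN v'c => h; rewrite inE ceq in_cons h orbT.
have -> : 3 = #|v' |: [set a; last a q]|.
  rewrite cardsU1 cards2 al !inE negb_or.
  have -> : v' != a by apply: contraNneq v'q => ->; rewrite mem_head.
  by have -> : v' != last a q by apply: contraNneq v'q => ->; rewrite mem_last.
by apply: subset_leq_card; rewrite !subUset !sub1set !inE euv ewa ewl.
Qed.

(** A connected graph with degrees at least 2 contains a cycle, and unless the
    graph is that cycle, the cycle has a vertex of degree at least 3.  Removing
    this vertex leaves a path that joins two of its neighbours. *)
Lemma forcing_branch A x0 :
    irreflexive e -> connected_set A ->
    (forall u v, u \in A -> e u v -> v \in A) ->
    (forall v, v \in A -> 2 <= deg v) -> x0 \in A -> 2 < deg x0 ->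
  exists2 S, determines S A & #|S| <= 1 + \sum_(v in A) (deg v - 2).
Proof.
move=> e_irr conA clA degA x0A d0.
have [c [cc uc sc cA]] := cycle_exists e_irr clA degA x0A.
have [w wc dw] : exists2 w, w \in c & 2 < deg w.
  have [//|Ac] := cycle_branch_or_all conA cA cc uc sc.
  by exists x0 => //; rewrite Ac inE in x0A.
have [a [q [paq ewa ewl al [wn ceq]]]] := cycle_nbrs cc uc sc wc.
have BA : [set x in a :: q] \subset A.
  by apply/subsetP => x; rewrite inE => xq; apply: cA; rewrite ceq inE xq orbT.
apply: (forcing_detour (B := [set x in a :: q]) (v1 := a) (v2 := last a q) (w := w)) => //.
- exact: connected_path.
- exact: cA.
- by rewrite inE.
- by rewrite inE mem_head.
- by rewrite inE mem_last.
- by apply/degA/(subsetP BA); rewrite inE mem_head.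
Qed.

End Forcing.

(** * Signs of the boundary operator *)

Section Signs.
Variables (T : finType).
Implicit Types (a b v : T) (u w : seq T) (s t : {set T}).

Local Notation rk a := (index a (enum T)).
Definition std_inversions w : nat := inversions w (enum T).

Lemma inversions_cons a w u : uniq (a :: w) ->
  inversions (a :: w) u =
    (count (fun b => index b u < index a u) w + inversions w u)%N.
Proof.
move=> /= /andP[aw uw]; rewrite /inversions.
set X := [set ab : T * T | _]; set Y := [set ab : T * T | _].
pose H := [set (a, b) | b in [set b in w | (index b u < index a u)%N]].
have -> : X = H :|: Y.
  apply/setP => -[x y]; rewrite !inE /=.
  have mH : ((x, y) \in H) = (x == a) && (y \in w) && (index y u < index x u)%N.
    apply/imsetP/idP => [[b + [-> ->]]|/andP[/andP[/eqP-> yw] iy]].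
      by rewrite inE eqxx.
    by exists y; rewrite // inE yw.
  rewrite mH [a == x]eq_sym [a == y]eq_sym.
  have [->|xa] := eqVneq x a; have [->|ya] := eqVneq y a;
    rewrite /= ?(negPf aw) ?ltnn ?ltn0 ?andbF ?orbF //.
have disj : H :&: Y = set0.
  apply/setP => -[x y]; rewrite !inE /=; apply/negP => /andP[/imsetP[b _ [-> _]]].
  by rewrite (negPf aw).
rewrite cardsU disj cards0 subn0 card_imset; last by move=> b b' [].
congr (_ + _)%N; rewrite -size_filter -(card_uniqP (filter_uniq _ uw)).
by apply: eq_card => b; rewrite inE mem_filter andbC.
Qed.

Lemma index_enum_neq a b : a != b -> index a (enum T) != index b (enum T).
Proof.
apply: contraNneq => ab; have := nth_index a (mem_enum T a).
by rewrite ab nth_index ?mem_enum // => ->.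
Qed.

Lemma uniq_middle w1 v w2 :
  uniq (w1 ++ v :: w2) = (v \notin w1 ++ w2) && uniq (w1 ++ w2).
Proof. by rewrite (perm_uniq (permEl (perm_catCA w1 [:: v] w2))). Qed.

(** This equation gives the parity that relates the position of [v] in an
    ordering, the sign of the ordering and the sign of the ordering without [v]:
    the pairs that contain [v] are inverted if the other entry is on the wrong
    side of [v].  The doubled summand vanishes modulo 2. *)
Lemma std_inversions_remove w1 v w2 : uniq (w1 ++ v :: w2) ->
  (std_inversions (w1 ++ v :: w2) + count (fun a => rk a < rk v) (w1 ++ v :: w2) =
   std_inversions (w1 ++ w2) + size w1 + 2 * count (fun a => rk a < rk v) w2)%N.
Proof.
rewrite /std_inversions; elim: w1 => [|a w1 IH] uw.
  by rewrite /= inversions_cons // ltnn; lia.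
have uw' : uniq (a :: w1 ++ w2).
  by move: uw; rewrite (uniq_middle (a :: w1)) => /andP[].
have av : a != v.
  by move: uw; rewrite /= mem_cat in_cons !negb_or => /andP[/and3P[]].
rewrite /= !inversions_cons // !count_cat /=.
have := IH (subseq_uniq (subseq_cons _ _) uw); rewrite !count_cat /= ltnn.
case: ltngtP (index_enum_neq av) => // _ _; rewrite ?add0n ?add1n; lia.
Qed.

(** Multiplicativity of the sign, with the enumeration of [T] as a common
    reference: two orderings disagree on a pair iff exactly one of them
    disagrees with the reference. *)
Lemma inversions_odd u w : uniq u -> u =i w ->
  odd (inversions u w) = odd (std_inversions u) (+) odd (std_inversions w).
Proof.
move=> uu uw.
(* pairs increasing in the reference order and inverted by x *)
pose Y x : {set T * T} := [set ab | [&& ab.1 \in u, ab.2 \in u,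
  (rk ab.1 < rk ab.2)%N & (index ab.2 x < index ab.1 x)%N]].
pose swap (X : {set T * T}) := [set (ab.2, ab.1) | ab in X].
have swapE X p : (p \in swap X) = ((p.2, p.1) \in X).
  by apply/imsetP/idP => [[[a b] abX ->]//|pX]; exists (p.2, p.1) => //; case: p pX.
have card_swap X : #|swap X| = #|X|.
  by apply: card_imset => -[a b] [a' b'] [-> ->].
have cardY x : x =i u -> #|Y x| = std_inversions x.
  move=> xu; rewrite -card_swap; apply: eq_card => -[a b].
  by rewrite swapE !inE /= !xu andbCA; do 2 congr (_ && _); rewrite andbC.
have neq a b : a != b -> a \in u -> index a u != index b u /\ index a w != index b w.
  move=> ab au; split; apply: contraNneq ab => iab.
    by rewrite -(nth_index a au) iab nth_index // -index_mem -iab index_mem.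
  rewrite uw in au.
  by rewrite -(nth_index a au) iab nth_index // -index_mem -iab index_mem.
have -> : inversions u w = (#|Y w :\: Y u| + #|Y u :\: Y w|)%N.
  rewrite -[X in (_ + X)%N]card_swap -cardsUI.
  have -> : (Y w :\: Y u) :&: swap (Y u :\: Y w) = set0.
    apply/setP => -[a b]; rewrite in_setI swapE !inE /=; apply/negP.
    by case/andP=> /andP[_ /and4P[_ _ h _]] /andP[_ /and4P[_ _ h' _]]; lia.
  rewrite cards0 addn0; apply: eq_card => -[a b].
  rewrite in_setU swapE !inE /=.
  case au: (a \in u); case bu: (b \in u) => //=.
  have [->|ab] := eqVneq a b; first by rewrite !ltnn.
  have [h1 h2] := neq a b ab au; have h3 := index_enum_neq ab.
  case: (ltngtP (index a u) (index b u)) h1 => // _ _.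
    case: (ltngtP (index a w) (index b w)) h2 => // _ _;
      by case: (ltngtP (index a (enum T)) _) h3.
  case: (ltngtP (index a w) (index b w)) h2 => // _ _;
    by case: (ltngtP (index a (enum T)) _) h3.
have := cardsID (Y u) (Y w); have := cardsID (Y w) (Y u).
rewrite setIC !cardY // => <- <-; rewrite !oddD.
by case: (odd _) (odd _) (odd _) => [] [] [].
Qed.

Section Incidence.
Variables (R : comPzRingType) (o : {set T} -> seq T) (K : {set {set T}}) (d : nat).
Hypothesis ho : orientation K o.

(** The entry of the boundary matrix, as a function of the two faces, so that
    sums over matrix indices become sums over faces. *)
Definition incidence t s : R :=
  \sum_(j < d.+1) (-1) ^+ j *
    simplex_coef R o (take j (o s) ++ drop j.+1 (o s)) t.

Definition ordering_sign s : R := (-1) ^+ std_inversions (o s).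

Definition rank_in s v : nat := #|[set a in s | (rk a < rk v)%N]|.

Lemma mem_orientation s : s \in K -> o s =i s.
Proof. by move=> sK x; rewrite (perm_mem (ho sK)) mem_enum. Qed.

Lemma uniq_orientation s : s \in K -> uniq (o s).
Proof. by move=> sK; rewrite (perm_uniq (ho sK)) enum_uniq. Qed.

Lemma size_orientation s : s \in K -> size (o s) = #|s|.
Proof. by move=> sK; rewrite (perm_size (ho sK)) -cardE. Qed.

Lemma incidence_out t s : t \in K -> s \in K -> ~~ (t \subset s) ->
  incidence t s = 0.
Proof.
move=> tK sK ts; apply: big1 => j _; rewrite /simplex_coef; case: ifP; last by rewrite mulr0.
move=> pe; case/negP: ts; apply/subsetP => x.
rewrite -(mem_orientation tK) -(mem_orientation sK) -(perm_mem pe) mem_cat.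
by case/orP; [exact: mem_take|exact: mem_drop].
Qed.

(** The orientations of the two faces contribute one sign each.  These cancel
    around a cycle, where every face occurs in two incidences; only the position
    of the removed vertex in a fixed order matters there. *)
Lemma incidence_remove s v : s \in K -> s :\ v \in K -> v \in s -> #|s| = d.+1 ->
  incidence (s :\ v) s =
    ordering_sign s * ordering_sign (s :\ v) * (-1) ^+ rank_in s v.
Proof.
move=> sK svK vs cs; have us := uniq_orientation sK.
have vo : v \in o s by rewrite mem_orientation.
have ltj : (index v (o s) < d.+1)%N by rewrite -cs -size_orientation // index_mem.
rewrite /incidence (bigD1 (Ordinal ltj)) //= [X in _ + X]big1 ?addr0; last first.
  move=> j jv; rewrite /simplex_coef; case: ifP; last by rewrite mulr0.
  move=> /perm_mem/(_ v); rewrite mem_orientation // in_setD1 eqxx /= mem_cat.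
  move/negbT; rewrite negb_or => /andP[v1 v2].
  case/negP: jv; apply/eqP/val_inj => /=.
  have jd : (j < size (o s))%N by rewrite size_orientation // cs.
  rewrite -{1}(cat_take_drop j (o s)) (drop_nth v jd) in vo.
  rewrite mem_cat in_cons (negPf v1) (negPf v2) orbF in vo.
  by rewrite (eqP vo) index_uniq.
set j := index v (o s); set w1 := take j (o s); set w2 := drop j.+1 (o s).
have ow : o s = w1 ++ v :: w2.
  by rewrite -[v in RHS](nth_index v vo) -drop_nth ?index_mem // cat_take_drop.
have sz1 : size w1 = j by rewrite size_take index_mem vo.
have /andP[vw us'] : (v \notin w1 ++ w2) && uniq (w1 ++ w2).
  by rewrite -uniq_middle -ow.
have memw : w1 ++ w2 =i o (s :\ v).
  move=> x; rewrite mem_orientation // in_setD1 -(mem_orientation sK) ow.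
  have [->|xv] := eqVneq x v; first exact: negPf.
  by rewrite !mem_cat in_cons (negPf xv).
have pe : perm_eq (w1 ++ w2) (o (s :\ v)).
  exact: uniq_perm us' (uniq_orientation svK) memw.
rewrite /simplex_coef pe.
have rkE : rank_in s v = count (fun a => rk a < rk v)%N (o s).
  rewrite -size_filter -(card_uniqP (filter_uniq _ us)).
  by apply: eq_card => a; rewrite inE mem_filter mem_orientation // andbC.
have := std_inversions_remove (etrans (congr1 uniq (esym ow)) us).
rewrite -ow -rkE sz1 => inv_eq.
rewrite /ordering_sign -!exprD -signr_odd -[RHS]signr_odd.
congr (_ ^+ (nat_of_bool _)); have := congr1 odd inv_eq.
rewrite !oddD /= addbF addbb addbF inversions_odd //.
by do 5! case: (odd _).
Qed.

Lemma incidence_sqr t s : t \in K -> s \in K -> t \subset s ->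
  #|t| = d -> #|s| = d.+1 -> incidence t s * incidence t s = 1.
Proof.
move=> tK sK ts ct cs.
have /cards1P[v vE] : #|s :\: t| == 1%N by rewrite cardsDS // ct cs subSnn.
have vst : v \in s :\: t by rewrite vE set11.
have /andP[vt vs] : (v \notin t) && (v \in s) by rewrite -in_setD.
have tE : t = s :\ v.
  by rewrite -vE setDDr setDv set0U; apply/esym/setIidPr.
rewrite tE incidence_remove -?tE // -expr2 !exprMn /ordering_sign.
by rewrite !sqrr_sign !mulr1.
Qed.

Lemma rank_in_remove s x y : x \in s ->
  rank_in s y = (rank_in (s :\ x) y + (rk x < rk y))%N.
Proof.
move=> xs; rewrite /rank_in; case: ltnP => xy.
  rewrite (cardsD1 x) inE xs xy add1n addn1; congr _.+1.
  by apply: eq_card => a; rewrite !inE andbA.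
rewrite addn0; apply: eq_card => a; rewrite !inE.
by have [->|//] := eqVneq a x; rewrite ltnNge xy andbF.
Qed.

(** If [U] is the union of the facets, these are [U :\ y], [U :\ x] and
    [U :\ z], and each of x, y, z is removed from two of them.  The ranks of x,
    y, z in [U] are counted twice in the total exponent; the corrections from
    [U] to the facets count the three pairs among x, y, z once each, so the
    exponent is odd. *)
Lemma incidence_three_cycle F0 F1 F2 (R0 := F0 :&: F1) (R1 := F1 :&: F2)
    (R2 := F2 :&: F0) :
    [/\ F0 \in K, F1 \in K & F2 \in K] -> [/\ R0 \in K, R1 \in K & R2 \in K] ->
    [/\ #|F0| = d.+1, #|F1| = d.+1 & #|F2| = d.+1] ->
    [/\ #|R0| = d, #|R1| = d & #|R2| = d] -> R0 != R1 -> R0 != R2 ->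
  (incidence R0 F0 * incidence R0 F1) * (incidence R1 F1 * incidence R1 F2) *
    (incidence R2 F2 * incidence R2 F0) = -1.
Proof.
move=> [F0K F1K F2K] [R0K R1K R2K] [c0 c1 c2] [r0 r1 r2] R01 R02.
have sub0 : R0 \subset F0 /\ R0 \subset F1 by rewrite subsetIl subsetIr.
have sub1 : R1 \subset F1 /\ R1 \subset F2 by rewrite subsetIl subsetIr.
have sub2 : R2 \subset F2 /\ R2 \subset F0 by rewrite subsetIl subsetIr.
have miss (s t : {set T}) : t \subset s -> #|s| = d.+1 -> #|t| = d ->
    exists2 v, v \in s & t = s :\ v.
  move=> ts cs ct.
  have /cards1P[v vE] : #|s :\: t| == 1%N by rewrite cardsDS // ct cs subSnn.
  exists v; first by have := set11 v; rewrite -vE in_setD => /andP[].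
  by rewrite -vE setDDr setDv set0U; apply/esym/setIidPr.
have [x xF0 R0x] := miss F0 R0 sub0.1 c0 r0.
have [y yF1 R0y] := miss F1 R0 sub0.2 c1 r0.
have [z zF0 R2z] := miss F0 R2 sub2.2 c0 r2.
have xF1 : x \notin F1.
  have : x \notin R0 by rewrite R0x setD11.
  by rewrite in_setI xF0.
have yF0 : y \notin F0.
  have : y \notin R0 by rewrite R0y setD11.
  by rewrite in_setI yF1 andbT.
have zF2 : z \notin F2.
  have : z \notin R2 by rewrite R2z setD11.
  by rewrite in_setI zF0 andbT.
have xF2 : x \in F2.
  apply: contraT => xF2; case/eqP: R02; apply/esym/eqP.
  by rewrite eqEcard r0 r2 leqnn andbT R0x subsetD1 sub2.2 in_setI (negPf xF2).
have yF2 : y \in F2.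
  apply: contraT => yF2; case/eqP: R01; apply/esym/eqP.
  by rewrite eqEcard r0 r1 leqnn andbT R0y subsetD1 sub1.1 in_setI (negPf yF2) andbF.
have zx : z != x by apply: contraNneq zF2 => ->.
have zF1 : z \in F1.
  by have : z \in R0; [rewrite R0x in_setD1 zx|rewrite in_setI => /andP[]].
have R1E v (s : {set T}) : v \in s -> R1 \subset s -> #|s| = d.+1 -> v \notin R1 -> R1 = s :\ v.
  move=> vs Rs cs vR; apply/eqP; rewrite eqEcard subsetD1 Rs vR /=.
  by move: cs; rewrite (cardsD1 v) vs r1 add1n => -[->].
have R1z : R1 = F1 :\ z by apply: R1E; rewrite ?sub1.1 // in_setI (negPf zF2) andbF.
have R1x : R1 = F2 :\ x by apply: R1E; rewrite ?sub1.2 // in_setI (negPf xF1).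
have R2y : R2 = F2 :\ y.
  apply/eqP; rewrite eqEcard subsetD1 sub2.1 in_setI (negPf yF0) andbF /=.
  by move: c2; rewrite (cardsD1 y) yF2 r2 add1n => -[->].
pose U := y |: F0.
have F0E : F0 = U :\ y by rewrite setU1K.
have xy : x != y by apply: contraNneq yF0 => <-.
have zy : z != y by apply: contraNneq yF0 => <-.
have F1E : F1 = U :\ x.
  rewrite -(setD1K yF1) -R0y R0x /U; apply/setP => a; rewrite !inE.
  by have [->|ax] := eqVneq a x; rewrite ?(negPf xy).
have F2E : F2 = U :\ z.
  rewrite -(setD1K yF2) -R2y R2z /U; apply/setP => a; rewrite !inE.
  by have [->|ax] := eqVneq a z; rewrite ?(negPf zy).
have xU : x \in U by rewrite !inE xF0 orbT.
have zU : z \in U by rewrite !inE zF0 orbT.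
have yU : y \in U by rewrite !inE eqxx.
have incE s t v : s \in K -> t \in K -> v \in s -> #|s| = d.+1 -> t = s :\ v ->
    incidence t s = ordering_sign s * ordering_sign t * (-1) ^+ rank_in s v.
  by move=> sK tK vs cs tE; rewrite {1}tE incidence_remove -?tE.
rewrite (incE F0 R0 x) // (incE F1 R0 y) // (incE F1 R1 z) // (incE F2 R1 x) //.
rewrite (incE F2 R2 y) // (incE F0 R2 z) //.
have sq s : ordering_sign s ^+ 2 = 1 by exact: sqrr_sign.
transitivity ((ordering_sign F0 ^+ 2 * ordering_sign F1 ^+ 2 * ordering_sign F2 ^+ 2) *
  (ordering_sign R0 ^+ 2 * ordering_sign R1 ^+ 2 * ordering_sign R2 ^+ 2) *
  (-1) ^+ (rank_in F0 x + rank_in F0 z + rank_in F1 y + rank_in F1 z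
           + rank_in F2 x + rank_in F2 y) : R).
  by rewrite !exprD; ring.
rewrite !sq !mul1r -signr_odd; set n := (_ + _)%N.
suff -> : odd n by rewrite expr1.
have cmp a b : a != b -> ((rk a < rk b) + (rk b < rk a) = 1)%N.
  by move/index_enum_neq; case: ltngtP.
have nE : (n + 3 = (rank_in U x + rank_in U y + rank_in U z).*2)%N.
  rewrite -!addnn {1}(rank_in_remove x yU) (rank_in_remove x zU).
  rewrite {1}(rank_in_remove z yU) (rank_in_remove z xU).
  rewrite {1}(rank_in_remove y xU) (rank_in_remove y zU) -F0E -F1E -F2E.
  have := cmp x y xy; have := cmp z x zx; have := cmp z y zy; rewrite /n.
  move: (rank_in F0 x) (rank_in F0 z) (rank_in F1 y) (rank_in F1 z)
    (rank_in F2 x) (rank_in F2 y).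
  move: (nat_of_bool (rk x < rk y)%N) (nat_of_bool (rk y < rk x)%N)
    (nat_of_bool (rk z < rk x)%N) (nat_of_bool (rk x < rk z)%N)
    (nat_of_bool (rk z < rk y)%N) (nat_of_bool (rk y < rk z)%N).
  clear; lia.
by have := congr1 odd nE; rewrite oddD odd_double; case: odd.
Qed.

End Incidence.
End Signs.

(** * The graph of nonfree ridges and nonpendant facets *)

Lemma ordSE m (i : 'I_m) : val (ordS i) = (if i.+1 == m then 0 else i.+1)%N.
Proof.
rewrite /=; case: eqP => [->|im]; first exact: modnn.
by rewrite modn_small //; have := ltn_ord i; lia.
Qed.

Lemma ordS_neq m (i : 'I_m) : (1 < m)%N -> ordS i != i.
Proof.
move=> m1; apply/eqP => /(congr1 val); rewrite ordSE.
by have := ltn_ord i; case: eqP => /=; lia.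
Qed.

Lemma ordS2_neq m (i : 'I_m) : (2 < m)%N -> ordS (ordS i) != i.
Proof.
move=> m2; apply/eqP => /(congr1 val); rewrite !ordSE.
by have := ltn_ord i; do 2 case: eqP => /=; lia.
Qed.

Lemma nth_cycle (V : eqType) (e : rel V) (c : seq V) x0 (i : 'I_(size c)) :
  cycle e c -> e (nth x0 c i) (nth x0 c (ordS i)).
Proof.
rewrite ordSE; case: c i => [[]//|a q] [i /= iq] /(pathP x0) pq.
have /pq : (i < size (rcons q a))%N by rewrite size_rcons.
rewrite -rcons_cons !nth_rcons /= iq eqSS; move: iq; rewrite ltnS leq_eqVlt.
by case: eqP => [->|_] //=; rewrite ?ltnn ?eqxx // => ->.
Qed.

Section FacetRidgeGraph.
Variables (T : finType) (K : {set {set T}}) (d : nat).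
Implicit Types (F G R s t : {set T}) (X Y : {set {set T}}).

Definition free_in F : {set {set T}} := [set R in free_ridges K d | R \subset F].
Definition nonfree_in F : {set {set T}} :=
  [set R in nonfree_ridges K d | R \subset F].
Definition inner_facets : {set {set T}} := facets K :\: pendant_facets K d.
Definition core : {set {set T}} := nonfree_ridges K d :|: inner_facets.
Definition core_adj : rel {set T} :=
  [rel s t | [&& s \in core, t \in core & (s \proper t) || (t \proper s)]].

Lemma core_adj_sym : symmetric core_adj.
Proof. by move=> s t; rewrite /core_adj /= andbCA orbC. Qed.

Lemma core_adj_irr : irreflexive core_adj.
Proof. by move=> s; rewrite /core_adj /= properxx !andbF. Qed.

Lemma core_adj_core s t : s \in core -> core_adj s t -> t \in core.
Proof. by move=> _ /and3P[]. Qed.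

Lemma double_count X Y :
  (\sum_(F in X) #|[set R in Y | R \subset F]| =
   \sum_(R in Y) #|[set F in X | R \subset F]|)%N.
Proof.
transitivity (\sum_(F in X) \sum_(R in Y | R \subset F) 1)%N.
  by apply: eq_bigr => F _; rewrite sum1dep_card.
rewrite (exchange_big_dep (mem Y)) /=; last by move=> F R _ /andP[].
apply: eq_bigr => R RY; rewrite -sum1dep_card.
by apply: eq_bigl => F; rewrite RY.
Qed.

Hypotheses (hd : (1 <= d)%N) (hK : simplicial_complex K) (hpure : pure K d).

Lemma facet_face F : F \in facets K -> F \in K.
Proof. by rewrite inE => /maxsetP[]. Qed.

Lemma card_ridge R : R \in ridges K d -> #|R| = d.
Proof. by rewrite !inE => /andP[_ /eqP->]; rewrite prednK. Qed.

Lemma face_sub_facet s : s \in K -> exists2 F, F \in facets K & s \subset F.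
Proof.
move=> sK; have [F mF sF] := maxset_exists (P := [in K]) sK.
by exists F; rewrite // inE.
Qed.

Lemma facetsE : facets K = faces K d.
Proof.
apply/setP => F; apply/idP/idP => [FF|]; first by rewrite inE (facet_face FF) (hpure FF) /=.
rewrite inE => /andP[FK cF]; have [G GK FG] := face_sub_facet FK.
suff -> : F = G by [].
by apply/eqP; rewrite eqEcard FG (hpure GK) (eqP cF) leqnn.
Qed.

Lemma ridge_notin_facets R : R \in ridges K d -> R \notin facets K.
Proof.
move=> RR; apply/negP => /hpure; rewrite (card_ridge RR) => /eqP.
by rewrite -[_ == _]/(d == d.+1) eqn_leq ltnn andbF.
Qed.

Lemma nonfree_ridge R : R \in nonfree_ridges K d -> R \in ridges K d.
Proof. by rewrite in_setD => /andP[]. Qed.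

Lemma free_ridge R : R \in free_ridges K d -> R \in ridges K d.
Proof. by rewrite inE => /andP[]. Qed.

Lemma ridge_sub F R : F \in facets K ->
  (R \in ridges K d) && (R \subset F) = (R \subset F) && (#|R| == d).
Proof.
move=> FF; rewrite andbC; case RF: (R \subset F) => //=.
by rewrite !inE prednK // (hK (facet_face FF) RF).
Qed.

(** All the subsets of a facet with d elements are ridges. *)
Lemma card_ridges_in F : F \in facets K ->
  #|[set R in ridges K d | R \subset F]| = d.+1.
Proof.
move=> FF; transitivity #|[set R : {set T} | R \subset F & #|R| == d]|.
  by apply: eq_card => R; rewrite in_set [in RHS]in_set -(ridge_sub _ FF).
by rewrite cards_draws (hpure FF) binSn.
Qed.

Lemma free_nonfree_in F : F \in facets K ->
  (#|free_in F| + #|nonfree_in F| = d.+1)%N.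
Proof.
move=> FF; rewrite -(card_ridges_in FF) -cardsUI.
have -> : free_in F :&: nonfree_in F = set0.
  apply/setP => R.
  rewrite in_setI in_set0 in_set [R \in nonfree_in _]in_set in_setD.
  by case: (R \in free_ridges K d); rewrite /= ?andbF.
rewrite cards0 addn0; apply: eq_card => R; rewrite in_setU [in RHS]in_set.
rewrite in_set [R \in nonfree_in _]in_set in_setD.
have := @free_ridge R; case: (R \in free_ridges K d) => [->|_] //=.
by rewrite orbF.
Qed.

Lemma pendantE F : F \in facets K ->
  (F \in pendant_facets K d) = (#|nonfree_in F| == 1)%N.
Proof.
move=> FF; rewrite in_set FF andTb -/(free_in F).
by have := free_nonfree_in FF => h; apply/eqP/eqP; lia.
Qed.

Lemma pendant_facet F : F \in pendant_facets K d -> F \in facets K.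
Proof. by rewrite inE => /andP[]. Qed.

Lemma nonfreeP R : reflect (R \in ridges K d /\ (2 <= #|facets_at K R|)%N)
  (R \in nonfree_ridges K d).
Proof.
rewrite in_setD [R \in free_ridges _ _]in_set; apply: (iffP andP).
  move=> [nf RR]; split=> //; move: nf; rewrite RR andTb => nf.
  have [|F FF RF] := @face_sub_facet R; first by move: RR; rewrite inE => /andP[].
  have : (0 < #|facets_at K R|)%N.
    by apply/card_gt0P; exists F; rewrite inE FF.
  by lia.
move=> [RR c2]; rewrite RR andTb; split=> //. by case: eqP c2 => // ->.
Qed.

Lemma nonfree_two R F : R \in nonfree_ridges K d ->
  exists2 G, G \in facets_at K R & G != F.
Proof.
case/nonfreeP => _ c2.
have : (0 < #|facets_at K R :\ F|)%N.
  by move: c2; rewrite (cardsD1 F); case: (F \in _) => //; rewrite add0n => /ltnW.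
by case/card_gt0P => G; rewrite in_setD1 => /andP[GF GR]; exists G.
Qed.

(** Two facets share at most one ridge. *)
Lemma ridge_setI R F G : R \in ridges K d -> F \in facets K -> G \in facets K ->
  F != G -> R \subset F -> R \subset G -> R = F :&: G.
Proof.
move=> RR FF GG FG RF RG; apply/eqP; rewrite eqEcard subsetI RF RG /=.
rewrite (card_ridge RR) leqNgt; apply/negP => cI; case/eqP: FG.
have FI : F :&: G = F.
  by apply/eqP; rewrite eqEcard subsetIl (hpure FF).
have GI : F :&: G = G.
  by apply/eqP; rewrite eqEcard subsetIr (hpure GG).
by rewrite -FI GI.
Qed.

Lemma shared_nonfree R F G : R \in ridges K d -> F \in facets K -> G \in facets K ->
  F != G -> R \subset F -> R \subset G -> R \in nonfree_ridges K d.
Proof.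
move=> RR FF GG FG RF RG; apply/nonfreeP; split=> //.
have <- : #|[set F; G]| = 2%N by rewrite cards2 FG.
by apply: subset_leq_card; rewrite subUset !sub1set ![_ \in facets_at _ _]in_set FF RF GG RG.
Qed.


Lemma card_nonfree_free :
  (#|nonfree_ridges K d| + #|free_ridges K d| = #|ridges K d|)%N.
Proof.
rewrite cardsDS ?subnK //; first apply: subset_leq_card.
  by apply/subsetP => R /free_ridge.
by apply/subsetP => R /free_ridge.
Qed.

Lemma card_inner :
  (#|inner_facets| + #|pendant_facets K d| = #|facets K|)%N.
Proof.
rewrite cardsDS ?subnK //; first apply: subset_leq_card.
  by apply/subsetP => R /pendant_facet.
by apply/subsetP => R /pendant_facet.
Qed.

Lemma core_disjoint : [disjoint nonfree_ridges K d & inner_facets].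
Proof.
rewrite -setI_eq0; apply/eqP/setP => s; rewrite in_setI in_set0.
apply/negP => /andP[/nonfree_ridge sR].
by rewrite in_setD (negPf (ridge_notin_facets sR)) andbF.
Qed.

Lemma card_core : (#|core| = #|nonfree_ridges K d| + #|inner_facets|)%N.
Proof.
by rewrite cardsU (_ : _ :&: _ = set0) ?cards0 ?subn0 //; apply/eqP; rewrite setI_eq0 core_disjoint.
Qed.

(** The left-hand side is the number of edges of the core, so theta is its
    cyclomatic number.  Of the (d+1) f_d incidences, every free ridge accounts
    for one, and so does every pendant facet with its only nonfree ridge. *)
Lemma euler_core :
  (\sum_(F in inner_facets) #|nonfree_in F|)%N%:Z = #|core|%:Z + theta K d - 1.
Proof.
have all_inc : (\sum_(F in facets K) (#|free_in F| + #|nonfree_in F|) =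
    #|facets K| * d.+1)%N.
  rewrite (eq_bigr (fun=> d.+1)); first by rewrite sum_nat_const.
  by move=> F; exact: free_nonfree_in.
have free_inc : (\sum_(F in facets K) #|free_in F| = #|free_ridges K d|)%N.
  rewrite double_count -sum1_card; apply: eq_bigr => R.
  by rewrite in_set => /andP[_ /eqP].
have pend_inc : (\sum_(F in pendant_facets K d) #|nonfree_in F| =
    #|pendant_facets K d|)%N.
  rewrite -sum1_card; apply: eq_bigr => F Fp.
  by apply/eqP; rewrite -pendantE // (pendant_facet Fp).
have split_inc : (\sum_(F in facets K) #|nonfree_in F| =
    #|pendant_facets K d| + \sum_(F in inner_facets) #|nonfree_in F|)%N.
  rewrite (big_setID (pendant_facets K d)) /= -pend_inc; congr (_ + _)%N.
  by apply: eq_bigl => F; rewrite in_setI andb_idl //; exact: pendant_facet.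
have arith (fr p E f i nf r : nat) : (fr + (p + E) = f * d.+1)%N ->
    (i + p = f)%N -> (nf + fr = r)%N ->
    E%:Z = (nf + i)%N%:Z + (d%:Z * f%:Z - r%:Z + 1) - 1 by nia.
rewrite card_core /theta -facetsE; apply: arith card_inner card_nonfree_free.
by rewrite -free_inc -split_inc -big_split.
Qed.

Lemma nbrs_facet F : F \in inner_facets -> nbrs core_adj F = nonfree_in F.
Proof.
move=> FI; have FF : F \in facets K by move: FI; rewrite in_setD => /andP[].
apply/setP => s; rewrite in_set [RHS]in_set /core_adj /=.
rewrite !in_setU FI orbT /=; apply/andP/andP => [[/orP[sR|sI]]|[sR sF]].
- move=> /orP[/proper_card|/proper_sub->//].
  by rewrite (hpure FF) (card_ridge (nonfree_ridge sR)) ltnNge leqnSn.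
- have sF : s \in facets K by move: sI; rewrite in_setD => /andP[].
  by move=> /orP[] /proper_card; rewrite (hpure FF) (hpure sF) ltnn.
split; first by rewrite sR.
by rewrite [s \proper F]properEcard sF (hpure FF) (card_ridge (nonfree_ridge sR)) ltnSn orbT.
Qed.

Lemma nbrs_ridge R : R \in nonfree_ridges K d ->
  nbrs core_adj R = facets_at K R :\: pendant_facets K d.
Proof.
move=> RN; apply/setP => F; rewrite in_setD [_ \in facets_at _ _]in_set in_set.
rewrite core_adj_sym andbA -[_ && (F \in facets K)]in_setD -/inner_facets.
have [FI|FnI] := boolP (F \in inner_facets).
  by have /setP/(_ R) := nbrs_facet FI; rewrite in_set => ->; rewrite in_set RN.
apply/negP => /and3P[+ _ /orP[|] /proper_card]; rewrite in_setU (negPf FnI) orbF.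
  by move=> /nonfree_ridge/card_ridge->; rewrite (card_ridge (nonfree_ridge RN)) ltnn.
by move=> /nonfree_ridge/card_ridge->; rewrite (card_ridge (nonfree_ridge RN)) ltnn.
Qed.

(** The handshake identity: both sides of the bipartite graph contribute the
    number of edges. *)
Lemma sum_deg_core :
  (\sum_(s in core) deg core_adj s)%N%:Z = 2 * (#|core|%:Z + theta K d - 1).
Proof.
rewrite /core (eq_bigl [predU nonfree_ridges K d & inner_facets]); last first.
  by move=> s; rewrite in_setU.
rewrite bigU ?core_disjoint //=.
rewrite -euler_core.
rewrite [X in (_ + X)%N](eq_bigr (fun F => #|nonfree_in F|)); last first.
  by move=> F FI; rewrite /deg nbrs_facet.
rewrite (eq_bigr (fun R => #|[set F in inner_facets | R \subset F]|)); last first.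
  move=> R RN; rewrite /deg nbrs_ridge //; apply: eq_card => F.
  by rewrite in_setD [RHS]in_set in_setD [_ \in facets_at _ _]in_set andbA.
by rewrite -double_count PoszD mulr_natl mulr2n.
Qed.

Hypotheses (hconn : ridge_connected K d) (h2 : (2 <= #|facets K|)%N).
Local Notation adj := core_adj.
Local Notation nonfree := (nonfree_ridges K d).
Local Notation inner := inner_facets.
Local Notation quasi := (quasi_pendant_ridges K d).

Lemma nonfree_core R : R \in nonfree -> R \in core.
Proof. by move=> RN; rewrite in_setU RN. Qed.

Lemma inner_core F : F \in inner -> F \in core.
Proof. by move=> FI; rewrite in_setU FI orbT. Qed.

Lemma inner_facet F : F \in inner -> F \in facets K.
Proof. by rewrite in_setD => /andP[]. Qed.

Lemma adj_facet F R : F \in inner -> R \in nonfree -> R \subset F -> adj R F.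
Proof.
move=> FI RN RF; rewrite core_adj_sym.
have /setP/(_ R) := nbrs_facet FI.
by rewrite in_set => ->; rewrite in_set RN.
Qed.

(** A facet without nonfree ridges would be alone in its component. *)
Lemma facet_nonfree F : F \in facets K -> exists2 R, R \in nonfree & R \subset F.
Proof.
move=> FF; have [G GF GnF] : exists2 G, G \in facets K & G != F.
  have : (0 < #|facets K :\ F|)%N.
    by move: h2; rewrite (cardsD1 F) FF add1n ltnS.
  by case/card_gt0P => G; rewrite in_setD1 => /andP[GnF GF]; exists G.
have /connectP[p pp lp] := hconn FF GF.
suff [H /andP[HnF /and3P[_ HF /exists_inP[R RR /andP[RF RH]]]]] :
    exists H, (H != F) && share_ridge K d F H.
  exists R => //; apply: (shared_nonfree RR FF HF) RF RH.
  by rewrite eq_sym.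
elim: p G pp lp GnF {GF} => [G _ /= -> |H p IH G]; first by rewrite eqxx.
move=> /andP[sFH pp] lp GnF.
have [HF|HnF] := eqVneq H F; last by exists H; rewrite HnF.
by rewrite HF /= in pp lp; apply: IH lp GnF.
Qed.

(** A chain of facets sharing ridges is followed through the shared ridges.  A
    facet with two nonfree ridges is not pendant, so the pendant facets of the
    chain are bypassed. *)
Lemma connect_nonfree R R' : R \in nonfree -> R' \in nonfree -> connect adj R R'.
Proof.
move=> RN R'N.
have [F] := nonfree_two set0 RN; rewrite in_set => /andP[FF RF] _.
have [F'] := nonfree_two set0 R'N; rewrite in_set => /andP[F'F R'F'] _.
have within F0 R1 R2 : F0 \in facets K -> R1 \in nonfree -> R2 \in nonfree ->
    R1 \subset F0 -> R2 \subset F0 -> connect adj R1 R2.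
  move=> FF0 R1N R2N R1F R2F; have [->|R12] := eqVneq R1 R2; first exact: connect0.
  have FI : F0 \in inner.
    rewrite in_setD FF0 andbT pendantE //; apply/eqP => c1.
    have : (#|[set R1; R2]| <= #|nonfree_in F0|)%N.
      apply: subset_leq_card; rewrite subUset !sub1set.
      by rewrite ![_ \in nonfree_in _]in_set R1N R2N R1F.
    by rewrite cards2 R12 c1.
  apply: connect_trans (connect1 (adj_facet FI R1N R1F)) _.
  by apply: connect1; rewrite core_adj_sym; apply: adj_facet.
have /connectP[p pp lp] := hconn FF F'F.
elim: p F R FF RF RN pp lp => [|G p IH] F R FF RF RN /=.
  by move=> _ F'E; apply: (within F) => //; rewrite -F'E.
case/andP=> /and3P[_ GF /exists_inP[S SR /andP[SF SG]]] pp lp.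
have [FG|FG] := eqVneq F G.
  by subst G; exact: (IH F R).
have SN := shared_nonfree SR FF GF FG SF SG.
by apply: connect_trans (within F _ _ FF RN SN RF SF) _; exact: (IH G S).
Qed.

Lemma connected_core : connected_set adj core.
Proof.
have csym := sym_connect_sym core_adj_sym.
have toR u : u \in core -> exists2 R, R \in nonfree & connect adj u R.
  rewrite in_setU => /orP[uN|uI]; first by exists u => //; exact: connect0.
  have [R RN RF] := facet_nonfree (inner_facet uI).
  by exists R => //; rewrite csym; apply/connect1/adj_facet.
apply: (connected_connect core_adj_sym).
  by move=> u v; exact: core_adj_core.
move=> u v uC vC; have [R RN uR] := toR u uC; have [R' R'N vR'] := toR v vC.
apply: connect_trans uR _; apply: connect_trans (connect_nonfree RN R'N) _.
by rewrite csym.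
Qed.

Lemma deg_inner F : F \in inner -> (2 <= deg adj F)%N.
Proof.
move=> FI; have FF := inner_facet FI.
rewrite /deg (nbrs_facet FI).
have [R RN RF] := facet_nonfree FF.
have : (0 < #|nonfree_in F|)%N.
  by apply/card_gt0P; exists R; rewrite in_set RN.
have : #|nonfree_in F| != 1%N.
  by rewrite -pendantE //; move: FI; rewrite in_setD => /andP[].
by case: #|_| => [|[]].
Qed.

(** At least two facets contain a nonfree ridge, so a missing neighbour in the
    core is a pendant facet. *)
Lemma low_deg_quasi s : s \in core -> (deg adj s <= 1)%N -> s \in quasi.
Proof.
rewrite in_setU => /orP[sN|/deg_inner]; last by rewrite ltnNge => /negPf->.
move=> deg1; rewrite in_set sN /=; apply: contraTT deg1 => /exists_inPn noF.
rewrite -ltnNge /deg nbrs_ridge //.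
have -> : facets_at K s :\: pendant_facets K d = facets_at K s.
  apply/setDidPl; rewrite disjoint_sym; apply/pred0P => F /=.
  apply/negP => /andP[Fp]; rewrite in_set => /andP[_ sF].
  by case/negP: (noF F Fp).
by case/nonfreeP: sN.
Qed.

Lemma nonfree_neq0 : exists s, s \in nonfree.
Proof.
have [F FF] : exists F, F \in facets K.
  by apply/card_gt0P; exact: ltnW h2.
by have [R RN _] := facet_nonfree FF; exists R.
Qed.

Lemma deg_gt0 s : s \in core -> #|core| != 1%N -> (0 < deg adj s)%N.
Proof.
move=> sC c1; have [t tC ts] : exists2 t, t \in core & t != s.
  have : (0 < #|core :\ s|)%N.
    by move: c1; rewrite (cardsD1 s) sC add1n eqSS lt0n.
  by case/card_gt0P => t; rewrite in_setD1 => /andP[ts tC]; exists t.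
have [|||u [v [us _ _ auv]]] := connected_core (D := [set s]) (u := s) (v := t) _ _ tC.
- by rewrite sub1set.
- exact: set11.
- by rewrite in_set1.
move: us; rewrite in_set1 => /eqP us; apply/card_gt0P; exists v.
by rewrite in_set -us.
Qed.

(** Each leaf contributes 0 to the left-hand side instead of -1. *)
Lemma excess_core : #|core| != 1%N ->
  (\sum_(s in core) (deg adj s - 2))%N%:Z =
    2 * (theta K d - 1) + #|[set s in core | deg adj s == 1%N]|%:Z.
Proof.
move=> c1.
have sum_nat : (\sum_(s in core) (deg adj s - 2) + #|core| * 2 =
    \sum_(s in core) deg adj s + #|[set s in core | deg adj s == 1%N]|)%N.
  rewrite -sum_nat_const -sum1dep_card big_mkcondr /= -!big_split /=.
  by apply: eq_bigr => s sC; have := deg_gt0 sC c1; case: eqP; lia.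
have arith (x c D l : nat) (th : int) : (x + c * 2 = D + l)%N ->
    D%:Z = 2 * (c%:Z + th - 1) -> x%:Z = 2 * (th - 1) + l%:Z by lia.
exact: arith sum_nat (sum_deg_core).
Qed.

Lemma leaves_core :
  (#|[set s in core | deg adj s == 1%N]| <= #|quasi|)%N.
Proof.
apply: subset_leq_card; apply/subsetP => s; rewrite in_set => /andP[sC /eqP d1].
by apply: low_deg_quasi; rewrite ?d1.
Qed.

Lemma pendant0 : #|quasi| = 0%N -> #|pendant_facets K d| = 0%N.
Proof.
move=> /eqP; rewrite cards_eq0 => /eqP q0; apply/eqP; rewrite cards_eq0.
apply/eqP/setP => F; rewrite in_set0; apply/negP => Fp.
have [R RN RF] := facet_nonfree (pendant_facet Fp).
have : R \in quasi by rewrite in_set RN /=; apply/exists_inP; exists F.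
by rewrite q0 in_set0.
Qed.

(** A single vertex of the core is a nonfree ridge, and all the facets around
    it are pendant. *)
Lemma single_core : #|core| = 1%N -> exists R,
  [/\ core = [set R], deg adj R = 0%N, theta K d = 0 & #|quasi| = 1%N].
Proof.
move=> c1; have [R RN] := nonfree_neq0; exists R.
have cR : core = [set R].
  move/eqP/cards1P: c1 => [s cs]; move: (nonfree_core RN).
  by rewrite cs in_set1 => /eqP->.
have degR : deg adj R = 0%N.
  apply/eqP; rewrite cards_eq0; apply/eqP/setP => s; rewrite in_set in_set0.
  apply/negP => aRs; have := core_adj_core (nonfree_core RN) aRs.
  by rewrite cR in_set1 => /eqP sR; rewrite sR core_adj_irr in aRs.
split=> //.
  have := sum_deg_core; rewrite c1 {1}cR big_set1 degR; lia.
apply/eqP/cards1P; exists R; apply/setP => s; rewrite in_set1.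
apply/idP/eqP => [|->]; last by apply: low_deg_quasi; rewrite ?nonfree_core ?degR.
by rewrite in_set => /andP[/nonfree_core]; rewrite cR in_set1 => /eqP.
Qed.

(** Exploring from [s] costs 1 for [s] itself and [deg s - 1] for its
    neighbours, which is 2 more than [deg s - 2], or 1 more if [s] is a leaf. *)
Lemma core_forcing_from s : s \in core -> #|core| != 1%N ->
  exists2 S, determines adj S core
    & #|S|%:Z <= 2 * theta K d + #|[set t in core | deg adj t == 1%N]|%:Z
                 - (deg adj s == 1%N)%:Z.
Proof.
move=> sC c1.
have [S SC cS] := forcing_from core_adj_sym connected_core sC.
exists S => //; have := excess_core c1; move: cS (deg_gt0 sC c1).
rewrite [in X in _ -> _ -> X -> _](big_setD1 s sC) /=.
case: eqP; lia.
Qed.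

Lemma core_forcing :
  exists2 S, determines adj S core
    & #|S|%:Z <= 2 * theta K d + #|quasi|%:Z.
Proof.
have [R RN] := nonfree_neq0; have RC := nonfree_core RN.
have [c1|c1] := eqVneq #|core| 1%N.
  have [S SC cS] := forcing_from core_adj_sym connected_core RC.
  exists S => //; have [R' [cR d0 -> ->]] := single_core c1.
  by move: RC cS; rewrite cR in_set1 => /eqP->; rewrite setDv big_set0 d0.
have [S SC cS] := core_forcing_from RC c1; exists S => //.
by have := leaves_core; lia.
Qed.

(** A leaf as a starting point saves one vertex.  Without leaves, either q > 0
    leaves room for one, or there are no pendant facets and, unless theta = 1,
    some degree exceeds 2, so that [forcing_branch] applies. *)
Lemma core_forcing_strict :
    #|core| != 1%N -> (theta K d, #|pendant_facets K d|) <> (1, 0%N) ->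
  exists2 S, determines adj S core
    & #|S|%:Z <= 2 * theta K d + #|quasi|%:Z - 1.
Proof.
move=> c1 th1; have [R RN] := nonfree_neq0; have RC := nonfree_core RN.
have leaves := leaves_core.
have [l0|[s]] := set_0Vmem [set s in core | deg adj s == 1%N]; last first.
  rewrite in_set => /andP[sC ds]; have [S SC cS] := core_forcing_from sC c1.
  by exists S => //; apply: le_trans cS _; rewrite ds lerD2r lerD2l lez_nat.
have [q0|q0] := posnP #|quasi|; last first.
  have [S SC cS] := core_forcing_from RC c1; exists S => //.
  by move: cS; rewrite l0 cards0; lia.
have excess := excess_core c1; rewrite l0 cards0 addr0 in excess.
have deg2 s : s \in core -> (2 <= deg adj s)%N.
  move=> sC; have := deg_gt0 sC c1; move/setP/(_ s): l0.
  by rewrite in_set0 in_set sC /=; case: deg => [|[]].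
have [/exists_inP[s sC ds]|/exists_inPn nos] :=
    boolP [exists s in core, (2 < deg adj s)%N].
  have [S SC cS] := forcing_branch core_adj_sym core_adj_irr
    connected_core core_adj_core deg2 sC ds.
  exists S => //; apply: (@le_trans _ _ (1 + 2 * (theta K d - 1))).
    by rewrite -excess -PoszD lez_nat.
  by rewrite q0; lia.
case: th1; congr pair; last exact: pendant0.
move: excess; rewrite big1; first by lia.
by move=> s /nos; rewrite -leqNgt => /eqP.
Qed.

(** * Extremal complexes *)

Lemma single_core_star : #|core| = 1%N -> ridge_star K d.
Proof.
move=> c1; have [R RN] := nonfree_neq0.
have [R' [cR' _ _ _]] := single_core c1.
have cR : core = [set R].
  by move: (nonfree_core RN); rewrite cR' in_set1 => /eqP->.
split=> //; exists R; first exact: nonfree_ridge.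
have only R0 : R0 \in nonfree -> R0 = R.
  by move/nonfree_core; rewrite cR in_set1 => /eqP.
split=> [F FF|R0 R0R R0nR].
  by have [R0 /only ->] := facet_nonfree FF.
by apply: contraNT R0nR => R0f; apply/eqP/only; rewrite in_setD R0f.
Qed.

Lemma star_bound : ridge_star K d -> 2 * theta K d + #|quasi|%:Z <= 1.
Proof.
case=> _ _ _ [R RR [Rall Rfree]].
have only R0 : R0 \in nonfree -> R0 = R.
  rewrite in_setD => /andP[nf R0R]; apply: contraNeq nf; exact: Rfree.
have RN : R \in nonfree.
  apply/nonfreeP => //; split=> //; apply: leq_trans h2 _; apply: subset_leq_card.
  by apply/subsetP => F FF; rewrite in_set FF Rall.
have innerE : inner = set0.
  apply/setP => F; rewrite in_setD in_set0; apply/negP => /andP[+ FF].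
  rewrite pendantE // => /cards1P[]; exists R; apply/setP => R0.
  rewrite in_set1 in_set; apply/andP/eqP => [[/only//]|->].
  by rewrite RN Rall.
have cR : core = [set R].
  apply/setP => s; rewrite in_setU innerE in_set0 orbF in_set1.
  by apply/idP/eqP => [/only|->].
have [|_ [_ _ -> ->] //] := single_core.
by rewrite cR cards1.
Qed.

(** Without pendant facets, all the degrees in the core are at least 2, and
    theta = 1 makes their average 2.  So every facet has two nonfree ridges and
    every nonfree ridge lies in two facets. *)
Section Unicyclic.
Hypotheses (th1 : theta K d = 1) (p0 : #|pendant_facets K d| = 0%N).

Lemma inner_all : inner = facets K.
Proof. by move/eqP: p0; rewrite cards_eq0 /inner_facets => /eqP->; rewrite setD0. Qed.

Lemma deg_unicyclic s : s \in core -> deg adj s = 2%N.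
Proof.
have deg2 t : t \in core -> (2 <= deg adj t)%N.
  move=> tC; rewrite leqNgt; apply/negP => /(low_deg_quasi tC).
  rewrite in_set => /andP[_ /exists_inP[F Fp _]].
  by move/eqP: p0; rewrite cards_eq0 => /eqP p0'; rewrite p0' in_set0 in Fp.
have c1 : #|core| != 1%N.
  apply/eqP => c1; have [R [_ _ th0 _]] := single_core c1.
  by move: th1; rewrite th0.
have := excess_core c1; rewrite th1 subrr mulr0 add0r.
have -> : [set t in core | deg adj t == 1%N] = set0.
  apply/setP => t; rewrite in_set0 in_set; apply/negP => /andP[/deg2 + /eqP d1].
  by rewrite d1.
rewrite cards0 => -[/eqP]; rewrite sum_nat_eq0 => /forall_inP all0 sC.
by apply/eqP; rewrite eqn_leq deg2 // andbT -subn_eq0 all0.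
Qed.

Lemma card_nonfree_in F : F \in facets K -> #|nonfree_in F| = 2%N.
Proof.
rewrite -inner_all => FI.
by rewrite -(deg_unicyclic (inner_core FI)) /deg nbrs_facet.
Qed.

Lemma card_facets_at R : R \in nonfree -> #|facets_at K R| = 2%N.
Proof.
move=> RN; rewrite -(deg_unicyclic (nonfree_core RN)) /deg nbrs_ridge //.
by move/eqP: p0; rewrite cards_eq0 => /eqP->; rewrite setD0.
Qed.

Lemma card_nonfree : #|nonfree| = #|facets K|.
Proof.
have := euler_core; rewrite inner_all th1 addrK card_core //.
rewrite inner_all (eq_bigr (fun=> 2%N)); last exact: card_nonfree_in.
rewrite sum_nat_const muln2 -addnn => -[/eqP]; rewrite eqn_add2r.
by move/eqP.
Qed.

(** The cyclic order of the facets is read off this graph, where it is a cycle,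
    rather than off the core, where facets alternate with ridges. *)
Definition facet_adj : rel {set T} :=
  [rel F G | (F != G) && share_ridge K d F G].

Lemma facet_adj_sym : symmetric facet_adj.
Proof.
move=> F G; rewrite /facet_adj /= eq_sym; congr (_ && _).
rewrite /share_ridge /= andbCA; do 2 congr (_ && _).
by apply/eq_existsb => R; rewrite [(R \subset F) && _]andbC.
Qed.

Lemma facet_adj_irr : irreflexive facet_adj.
Proof. by move=> F; rewrite /facet_adj /= eqxx. Qed.

Lemma facet_adjP F G : facet_adj F G ->
  [/\ F \in facets K, G \in facets K, F != G & F :&: G \in nonfree].
Proof.
case/and4P=> FG FF GF /exists_inP[R RR /andP[RF RG]]; split=> //.
rewrite -(ridge_setI RR FF GF FG RF RG).
exact: (shared_nonfree RR FF GF FG).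
Qed.

Lemma connected_facets : connected_set facet_adj (facets K).
Proof.
apply: (connected_connect facet_adj_sym).
  by move=> F G _ /facet_adjP[].
move=> F G FF GF; apply: connect_sub (hconn FF GF) => F' G' sFG.
have [->|FG] := eqVneq F' G'; first exact: connect0.
by apply: connect1; rewrite /facet_adj /= FG.
Qed.

Lemma deg_facet_adj F : F \in facets K -> deg facet_adj F = 2%N.
Proof.
move=> FF; have /eqP/cards2P[R1 [R2 [R12 NF]]] := card_nonfree_in FF.
have inN R : (R \in nonfree) && (R \subset F) = (R == R1) || (R == R2).
  by have /setP/(_ R) := NF; rewrite in_set => ->; rewrite in_set2.
have /andP[R1N R1F] : (R1 \in nonfree) && (R1 \subset F) by rewrite inN eqxx.
have /andP[R2N R2F] : (R2 \in nonfree) && (R2 \subset F) by rewrite inN eqxx orbT.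
have nbrsE : nbrs facet_adj F = (facets_at K R1 :\ F) :|: (facets_at K R2 :\ F).
  apply/setP => G; rewrite in_set in_setU !in_setD1.
  rewrite ![_ \in facets_at _ _]in_set.
  apply/idP/idP => [FG|].
    have [_ GF nFG FGN] := facet_adjP FG; rewrite GF eq_sym nFG /=.
    have := inN (F :&: G); rewrite FGN subsetIl => /esym/orP[] /eqP <-;
    by rewrite subsetIr ?orbT.
  have share R : R \in nonfree -> R \subset F ->
      [&& G != F, G \in facets K & R \subset G] -> facet_adj F G.
    move=> RN RF /and3P[GnF GF RG]; rewrite /facet_adj /share_ridge /= eq_sym GnF FF GF /=.
    by apply/exists_inP; exists R; rewrite ?RF // nonfree_ridge.
  by case/orP; exact: share.
have c1 R : R \in nonfree -> R \subset F -> #|facets_at K R :\ F| = 1%N.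
  move=> RN RF; have := card_facets_at RN; rewrite (cardsD1 F).
  by rewrite [F \in facets_at _ _]in_set FF RF => -[].
rewrite /deg nbrsE cardsU !c1 //.
suff -> : (facets_at K R1 :\ F) :&: (facets_at K R2 :\ F) = set0 by rewrite cards0.
apply/setP => G; rewrite in_set0 in_setI !in_setD1 ![_ \in facets_at _ _]in_set.
apply/negP => /andP[/and3P[GF GG R1G] /and3P[_ _ R2G]]; case/eqP: R12.
rewrite eq_sym in GF.
rewrite (ridge_setI (nonfree_ridge R1N) FF GG GF R1F R1G).
by rewrite -(ridge_setI (nonfree_ridge R2N) FF GG GF R2F R2G).
Qed.

(** A cycle of facets in a connected graph with degrees 2 contains all the
    facets.  The common ridges of consecutive facets are distinct because there
    are at least three facets, and by counting they are all the nonfree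
    ridges. *)
Lemma unicyclic_cycle : simplicial_cycle K d.
Proof.
have [F0 F0F] : exists F, F \in facets K by apply/card_gt0P; exact: ltnW h2.
have [||c [cc uc sc cF]] := cycle_exists facet_adj_sym facet_adj_irr
    (A := facets K) _ _ F0F.
- by move=> F G _ /facet_adjP[].
- by move=> F FF; rewrite deg_facet_adj.
have cE : facets K = [set F in c].
  have [[w wc]|//] := cycle_branch_or_all facet_adj_sym connected_facets cF cc uc sc.
  by rewrite deg_facet_adj ?cF.
pose m := size c; pose Fi (i : 'I_m) := nth F0 c i.
pose Ri (i : 'I_m) := Fi i :&: Fi (ordS i).
have Fi_inj : injective Fi.
  by move=> i j /eqP; rewrite nth_uniq // => /eqP/val_inj.
have FiP i : Fi i \in facets K by rewrite cE in_set mem_nth.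
have adjF i : facet_adj (Fi i) (Fi (ordS i)) by exact: nth_cycle.
have RiN i : Ri i \in nonfree by have [] := facet_adjP (adjF i).
have atE i : facets_at K (Ri i) = [set Fi i; Fi (ordS i)].
  apply/esym/eqP; rewrite eqEcard card_facets_at ?RiN //.
  have [FF GF FG _] := facet_adjP (adjF i).
  rewrite subUset !sub1set cards2 FG ![_ \in facets_at _ _]in_set FF GF.
  by rewrite subsetIl subsetIr.
have Ri_inj : injective Ri.
  move=> i j Rij; have atij : [set Fi i; Fi (ordS i)] = [set Fi j; Fi (ordS j)].
    by rewrite -!atE Rij.
  have := set21 (Fi i) (Fi (ordS i)); rewrite atij in_set2 !(inj_eq Fi_inj).
  case/orP=> [/eqP//|/eqP ij].
  have := set21 (Fi j) (Fi (ordS j)); rewrite -atij in_set2 !(inj_eq Fi_inj).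
  case/orP=> [/eqP//|/eqP ji].
  by have := ordS2_neq j sc; rewrite -ij -ji eqxx.
split=> //; exists m, Fi, Ri; split=> //.
- split=> //; apply/setP => F; rewrite cE in_set; apply/imsetP/idP => [[i _ ->]|Fc].
    by rewrite mem_nth.
  have ltF : (index F c < m)%N by rewrite index_mem.
  by exists (Ordinal ltF); rewrite // /Fi nth_index.
- by split=> // i; apply: nonfree_ridge.
- split=> //; apply/eqP; rewrite eqEcard; apply/andP; split.
    by apply/subsetP => _ /imsetP[i _ ->].
  rewrite card_nonfree card_imset // card_ord cE.
  by rewrite cardsE (card_uniqP uc).
Qed.

End Unicyclic.

(** In a cycle every facet has two nonfree ridges, so there are no pendant
    facets; there are as many nonfree ridges as facets, each in two facets. *)
Lemma cycle_bound : simplicial_cycle K d -> 2 * theta K d + #|quasi|%:Z <= 2.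
Proof.
case=> _ _ [m [F [R [m3 [Finj FE] [Rinj RR] [RE atE RN]]]]].
have m1 : (1 < m)%N by exact: ltnW.
have FF i : F i \in facets K by rewrite -FE imset_f.
have RNi i : R i \in nonfree by rewrite -RN imset_f.
have RF i : R i \subset F i by rewrite RE subsetIl.
have RFS i : R (ord_pred i) \subset F i by rewrite RE ord_predK subsetIr.
have p0 : pendant_facets K d = set0.
  apply/setP => G; rewrite in_set0; apply/negP => Gp.
  have GF := pendant_facet Gp; move: GF Gp; rewrite -{1}FE => /imsetP[i _ ->].
  rewrite pendantE // => /eqP c1.
  have : (#|[set R i; R (ord_pred i)]| <= #|nonfree_in (F i)|)%N.
    by apply: subset_leq_card; rewrite subUset !sub1set ![_ \in nonfree_in _]in_set !RNi RF RFS.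
  rewrite c1 cards2 (inj_eq Rinj).
  suff -> : i != ord_pred i by [].
  by rewrite -{1}[i]ord_predK ordS_neq.
have q0 : quasi = set0.
  apply/setP => S; rewrite in_set0 in_set; apply/negP => /andP[_ /exists_inP[G]].
  by rewrite p0 in_set0.
have innerE : inner = facets K by rewrite /inner_facets p0 setD0.
have fm : #|facets K| = m by rewrite -FE card_imset // card_ord.
have nm : #|nonfree| = m by rewrite -RN card_imset // card_ord.
have inc : (\sum_(F in facets K) #|nonfree_in F| = m * 2)%N.
  rewrite double_count -nm -sum_nat_const; apply: eq_bigr => S.
  rewrite -RN => /imsetP[i _ ->].
  rewrite -/(facets_at K (R i)) atE cards2 (inj_eq Finj) eq_sym.
  by rewrite ordS_neq.
have := euler_core; rewrite card_core // innerE fm nm inc q0 cards0; lia.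
Qed.

(** * Spread of zeros and the upper bound *)

Section Spectrum.
Variables (Real : realType) (o : {set T} -> seq T).
Hypothesis ho : orientation K o.
Local Notation inc := (incidence Real o d).
Local Notation D := (boundary Real o K d).

Lemma ridge_face R : R \in ridges K d -> R \in K.
Proof. by rewrite inE => /andP[]. Qed.

Lemma inc_sqr R F : R \in ridges K d -> F \in facets K -> R \subset F ->
  inc R F * inc R F = 1.
Proof.
move=> RR FF RF; apply: (incidence_sqr _ ho) => //.
- exact: ridge_face.
- exact: facet_face.
- exact: card_ridge.
- exact: hpure.
Qed.

Lemma inc_out R F : R \in ridges K d -> F \in facets K -> ~~ (R \subset F) ->
  inc R F = 0.
Proof.
by move=> RR FF; exact: (incidence_out _ _ ho (ridge_face RR) (facet_face FF)).
Qed.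

Lemma inc_neq0 R F : R \in ridges K d -> F \in facets K -> R \subset F ->
  inc R F != 0.
Proof.
move=> RR FF RF; apply: contra_eq_neq (inc_sqr RR FF RF) => ->.
by rewrite mul0r eq_sym oner_neq0.
Qed.

Lemma free_facet R F G : R \in free_ridges K d -> F \in facets K ->
  G \in facets K -> R \subset F -> R \subset G -> G = F.
Proof.
rewrite in_set => /andP[_ /cards1P[H atR]] FF GF RF RG.
have atE G' : G' \in facets K -> R \subset G' -> G' = H.
  move=> G'F RG'; have : G' \in facets_at K R by rewrite in_set G'F.
  by rewrite atR in_set1 => /eqP.
by rewrite (atE F FF RF) (atE G GF RG).
Qed.

Lemma sum_free (y : {set T} -> Real) R F : R \in free_ridges K d ->
  F \in facets K -> R \subset F ->
  \sum_(G in facets K) inc R G * y G = inc R F * y F.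
Proof.
move=> Rf FF RF; rewrite (bigD1 F) //= big1 ?addr0 // => G /andP[GF GnF].
rewrite inc_out ?mul0r ?free_ridge //; apply: contraNN GnF => RG.
by apply/eqP; apply: free_facet RF RG.
Qed.

(** The function [z] takes the values of an eigenvector on the ridges and those
    of its coboundary on the facets. *)
Section Vanishing.
Variables (lam : Real) (z : {set T} -> Real).
Hypotheses (lam0 : 0 < lam) (lamd : lam != d%:R).
Hypothesis z_ridge : forall R, R \in ridges K d ->
  lam * z R = \sum_(F in facets K) inc R F * z F.
Hypothesis z_facet : forall F, F \in facets K ->
  z F = \sum_(R in ridges K d) inc R F * z R.

Lemma free_value R F : R \in free_ridges K d -> F \in facets K -> R \subset F ->
  lam * z R = inc R F * z F.
Proof. by move=> Rf FF RF; rewrite z_ridge ?free_ridge // (sum_free _ Rf FF). Qed.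

Lemma free_vanish R F : R \in free_ridges K d -> F \in facets K -> R \subset F ->
  z F = 0 -> z R = 0.
Proof.
move=> Rf FF RF zF; have := free_value Rf FF RF; rewrite zF mulr0 => /eqP.
by rewrite mulf_eq0 gt_eqF //= => /eqP.
Qed.

(** The d free ridges of [F] give the relation lam z(F) = d z(F) once the
    nonfree ridge has value 0. *)
Lemma pendant_vanish R F : F \in pendant_facets K d -> R \in nonfree ->
  R \subset F -> z R = 0 -> z F = 0.
Proof.
move=> Fp RN RF zR; have FF := pendant_facet Fp.
have /cards1P[R' NF] : #|nonfree_in F| == 1%N by rewrite -pendantE.
have only r : r \in nonfree -> r \subset F -> r = R.
  move=> rN rF; have : r \in nonfree_in F by rewrite in_set rN.
  have : R \in nonfree_in F by rewrite in_set RN.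
  by rewrite NF !in_set1 => /eqP-> /eqP.
have zFd : lam * z F = d%:R * z F.
  rewrite {1}z_facet // mulr_sumr.
  have -> : d%:R * z F = \sum_(r in free_in F) z F.
    by rewrite sumr_const mulr_natl; move: Fp; rewrite in_set => /andP[_ /eqP->].
  rewrite [RHS]big_mkcond [LHS]big_mkcond; apply: eq_bigr => r _.
  rewrite [r \in free_in F]in_set; have [rf|rnf] := boolP (r \in free_ridges K d).
    rewrite free_ridge //=; case: ifP => rF; last first.
      by rewrite inc_out ?mul0r ?mulr0 ?free_ridge ?rF.
    by rewrite mulrCA (free_value rf FF rF) mulrA inc_sqr ?free_ridge // mul1r.
  case: ifP => //= rR; have [rF|rF] := boolP (r \subset F).
    by rewrite (only r) ?zR ?mulr0 // in_setD rnf.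
  by rewrite inc_out ?mul0r ?mulr0.
by move/eqP: zFd; rewrite -subr_eq0 -mulrBl mulf_eq0 subr_eq0 (negPf lamd) => /eqP.
Qed.

Lemma vanishing_closed : forcing_closed adj [set s | z s == 0].
Proof.
move=> s w; rewrite !in_set => /eqP zs asw others.
have othersE u : adj s u -> u != w -> z u = 0.
  by move=> asu uw; have := others u asu uw; rewrite in_set => /eqP.
have /and3P[sC wC _] := asw.
have wN : w \in nbrs adj s by rewrite in_set.
move: sC; rewrite in_setU => /orP[sN|sI]; apply/eqP.
- have sR := nonfree_ridge sN.
  move: wN; rewrite nbrs_ridge // in_setD [_ \in facets_at _ _]in_set => /and3P[_ wF sw].
  have := z_ridge sR; rewrite zs mulr0 (bigD1 w) //= big1 ?addr0; last first.
    move=> G /andP[GF Gw]; have [sG|sG] := boolP (s \subset G); last first.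
      by rewrite inc_out // mul0r.
    have [Gp|Gp] := boolP (G \in pendant_facets K d).
      by rewrite (pendant_vanish Gp sN sG zs) mulr0.
    by rewrite othersE ?mulr0 //; apply: adj_facet => //; rewrite in_setD Gp.
  by move/esym/eqP; rewrite mulf_eq0 (negPf (inc_neq0 sR wF sw)) => /eqP.
- have sF := inner_facet sI.
  move: wN; rewrite nbrs_facet // in_set => /andP[wN ws].
  have := z_facet sF; rewrite zs (bigD1 w) ?nonfree_ridge //= big1 ?addr0; last first.
    move=> r /andP[rR rw]; have [rs|rs] := boolP (r \subset s); last first.
      by rewrite inc_out // mul0r.
    have [rf|rnf] := boolP (r \in free_ridges K d).
      by rewrite (free_vanish rf sF rs zs) mulr0.
    rewrite othersE ?mulr0 //; rewrite core_adj_sym; apply: adj_facet => //.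
    by rewrite in_setD rnf.
  move/esym/eqP; rewrite mulf_eq0 (negPf (inc_neq0 _ sF ws)) ?nonfree_ridge //.
  by move/eqP.
Qed.

Lemma vanishing_forced S : determines adj S core -> (forall s, s \in S -> z s = 0) ->
  forall R, R \in ridges K d -> z R = 0.
Proof.
move=> SC zS R RR.
have zC s : s \in core -> z s = 0.
  move=> sC; have [|+ _] := SC [set s | z s == 0] _ vanishing_closed s sC.
    by apply/subsetP => t tS; rewrite in_set zS.
  by rewrite in_set => /eqP.
have [Rf|Rnf] := boolP (R \in free_ridges K d); last first.
  by apply/zC/nonfree_core; rewrite in_setD Rnf.
have /card_gt0P[F] : (0 < #|facets_at K R|)%N.
  by move: Rf; rewrite in_set => /andP[_ /eqP->].
rewrite in_set => /andP[FF RF]; apply: (free_vanish Rf FF RF).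
have [Fp|Fp] := boolP (F \in pendant_facets K d).
  have [R' R'N R'F] := facet_nonfree FF.
  by apply: (pendant_vanish Fp R'N R'F); apply/zC/nonfree_core.
by apply/zC/inner_core; rewrite in_setD Fp.
Qed.

End Vanishing.

(** The values of [z] on [S] define a linear map on the eigenspace, which is
    injective. *)
Lemma multiplicity_le (lam : Real) S : 0 < lam -> lam != d%:R -> determines adj S core ->
  (multiplicity o K d lam <= #|S|)%N.
Proof.
move=> lam0 lamd SC; rewrite /multiplicity; set E := eigenspace _ _.
(* W r s is the coefficient of the value at r in the value of z at s *)
pose W (r s : {set T}) : Real := if #|s| == d then (r == s)%:R else inc r s.
pose A : 'M[Real]_(#|faces K d.-1|, #|S|) :=
  \matrix_(i, j) W (enum_val i) (enum_val j).
rewrite -(mxrank_mul_ker E A); suff -> : (E :&: kermx A)%MS = 0.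
  by rewrite mxrank0 addn0 rank_leq_col.
apply/eqP; rewrite -submx0; apply/rV_subP => v; rewrite sub_capmx => /andP[].
move=> /eigenspaceP vE /sub_kermxP vA.
rewrite submx0; apply/eqP/rowP => i; rewrite mxE.
pose z s := \sum_i v 0 i * W (enum_val i) s.
have zR j : z (enum_val j) = v 0 j.
  have cj : #|enum_val j| = d by apply: card_ridge; exact: enum_valP.
  rewrite /z /W cj eqxx (bigD1 j) //= eqxx mulr1 big1 ?addr0 // => l lj.
  by rewrite (inj_eq enum_val_inj) (negPf lj) mulr0.
have zF j : z (enum_val j) = (v *m D) 0 j.
  have cj : #|enum_val j| = d.+1.
    by apply: hpure; rewrite facetsE; exact: enum_valP.
  rewrite /z /W cj eqn_leq ltnn mxE; apply: eq_bigr => l _.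
  by rewrite [D _ _]mxE.
rewrite -zR; apply: (vanishing_forced lam0 lamd _ _ SC); last exact: enum_valP.
- move=> R RR; have RK : R \in faces K d.-1 by [].
  rewrite -(enum_rankK_in RK RK) zR.
  have /rowP/(_ (enum_rank_in RK R)) := vE; rewrite [(lam *: v) _ _]mxE => <-.
  rewrite mulmxA mxE facetsE [RHS]big_enum_val; apply: eq_bigr => j _.
  by rewrite zF mulrC [(_^T) _ _]mxE [D _ j]mxE.
- move=> F; rewrite {1}facetsE => FK; rewrite -(enum_rankK_in FK FK) zF mxE.
  rewrite /ridges [RHS]big_enum_val; apply: eq_bigr => j _.
  by rewrite zR mulrC [D _ _]mxE.
- move=> s sS; rewrite -(enum_rankK_in sS sS).
  have /rowP/(_ (enum_rank_in sS s)) := vA; rewrite !mxE => <-.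
  by apply: eq_bigr => l _; rewrite mxE.
Qed.

(** * Eigenvectors of ridge-stars and simplicial cycles *)

(** The operator D^T D on the facets, which has the same nonzero eigenvalues as
    the upper Laplacian on the ridges, with the same multiplicities. *)
Definition down_laplacian (y : {set T} -> Real) F : Real :=
  \sum_(R in ridges K d) inc R F * \sum_(G in facets K) inc R G * y G.

Lemma down_laplacianE y F : F \in facets K ->
  down_laplacian y F = d.+1%:R * y F +
    \sum_(R in nonfree_in F) inc R F *
      \sum_(G in facets_at K R :\ F) inc R G * y G.
Proof.
move=> FF; rewrite /down_laplacian.
have split R : R \in ridges K d -> R \subset F ->
    inc R F * (\sum_(G in facets K) inc R G * y G) =
    y F + inc R F * \sum_(G in facets_at K R :\ F) inc R G * y G.
  move=> RR RF; rewrite (bigD1 F) //= mulrDr mulrA inc_sqr // mul1r.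
  congr (_ + _ * _); rewrite big_mkcond [RHS]big_mkcond; apply: eq_bigr => G _.
  rewrite in_setD1 [_ \in facets_at _ _]in_set.
  have [GF|_] := boolP (G \in facets K); case: (G != F) => //=.
  by case: ifP => // /negbT RG; rewrite inc_out // mul0r.
rewrite (bigID (fun R => R \subset F)) /= [X in _ + X]big1 ?addr0; last first.
  by move=> R /andP[RR RF]; rewrite inc_out ?mul0r.
rewrite (eq_bigr (fun R => y F + inc R F *
    \sum_(G in facets_at K R :\ F) inc R G * y G)); last first.
  by move=> R /andP[RR RF]; exact: split.
rewrite big_split /=; congr (_ + _).
  by rewrite -[LHS]big_set sumr_const card_ridges_in // mulr_natl.
rewrite [RHS]big_mkcond [LHS]big_mkcond; apply: eq_bigr => R _.
rewrite [R \in nonfree_in F]in_set in_setD; have [Rf|//] := boolP (R \in free_ridges K d).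
rewrite /=; case: ifP => // /andP[RR RF]; rewrite big1 ?mulr0 // => G.
rewrite in_setD1 [_ \in facets_at _ _]in_set => /and3P[GnF GF RG].
by case/eqP: GnF; apply: free_facet RF RG.
Qed.

(** The boundary operator maps an eigenspace of D^T D into the eigenspace of
    D D^T for the same eigenvalue, injectively if the eigenvalue is not 0. *)
Lemma multiplicity_ge n (y : 'I_n -> {set T} -> Real) (lam : Real) :
    lam != 0 ->
    (forall i F, F \in facets K -> down_laplacian (y i) F = lam * y i F) ->
    (forall c : 'I_n -> Real,
      (forall F, F \in facets K -> \sum_i c i * y i F = 0) -> forall i, c i = 0) ->
  (n <= multiplicity o K d lam)%N.
Proof.
move=> lam0 eig indep; pose Y : 'M[Real]_(n, #|faces K d|) := \matrix_(i, j) y i (enum_val j).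
have YD : Y *m D^T *m D = lam *: Y.
  apply/matrixP => i j; rewrite [RHS]mxE [Y i j]mxE -eig; last first.
    by rewrite facetsE; exact: enum_valP.
  rewrite mxE /down_laplacian /ridges [RHS]big_enum_val; apply: eq_bigr => l _.
  rewrite mulrC [D _ _]mxE; congr (_ * _).
  rewrite mxE facetsE [RHS]big_enum_val; apply: eq_bigr => q _.
  by rewrite !mxE mulrC.
have freeY : row_free Y.
  apply: inj_row_free => v vY; apply/rowP => i; rewrite [RHS]mxE.
  apply: (indep (fun i => v 0 i)) => F; rewrite facetsE => FK.
  transitivity ((v *m Y) 0 (enum_rank_in FK F)); last by rewrite vY mxE.
  by rewrite mxE; apply: eq_bigr => q _; rewrite [Y _ _]mxE enum_rankK_in.
have rankY : \rank (Y *m D^T) = n.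
  apply/eqP; rewrite eqn_leq rank_leq_row -{1}(eqP freeY).
  by rewrite -(mxrank_scale_nz _ lam0) -YD mxrankM_maxl.
rewrite -{1}rankY; apply: mxrankS; apply/eigenspaceP.
by rewrite /ridge_laplacian mulmxA YD scalemxAl.
Qed.

Lemma eigenvalue_multiplicity (lam : Real) : (0 < multiplicity o K d lam)%N ->
  eigenvalue (ridge_laplacian Real o K d) lam.
Proof. by rewrite lt0n mxrank_eq0. Qed.

(** The incidences with the central ridge form an eigenvector. *)
Lemma star_eigenvalue : ridge_star K d ->
  (1 <= multiplicity o K d ((d + #|facets K|)%:R : Real))%N.
Proof.
case=> _ _ _ [R RR [Rall Rfree]].
have only R0 : R0 \in nonfree -> R0 = R.
  rewrite in_setD => /andP[nf R0R]; apply: contraNeq nf; exact: Rfree.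
have atR : facets_at K R = facets K.
  by apply/setP => F; rewrite in_set andb_idr // => /Rall.
have RN : R \in nonfree by apply/nonfreeP; rewrite atR.
apply: (multiplicity_ge (y := fun _ => inc R)).
- by rewrite pnatr_eq0 addn_eq0 negb_and -!lt0n hd.
- move=> _ F FF; rewrite down_laplacianE //.
  have -> : nonfree_in F = [set R].
    apply/setP => R0; rewrite in_set in_set1.
    by apply/andP/eqP => [[/only]|->] //; rewrite RN Rall.
  rewrite big_set1 atR (eq_bigr (fun=> 1)); last first.
    by move=> G /setD1P[_ GF]; rewrite inc_sqr ?Rall.
  rewrite sumr_const; have := cardsD1 F (facets K); rewrite FF => ->.
  by rewrite addnA addn1 [inc R F * _]mulrC -mulrDl -natrD.
- move=> c c0 i; have [F FF] : exists F, F \in facets K.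
    by apply/card_gt0P; exact: ltnW h2.
  have /eqP := c0 F FF; rewrite big_ord1 mulf_eq0 (negPf (inc_neq0 _ _ _)) ?Rall //.
  by rewrite orbF (ord1 i) => /eqP.
Qed.

Section CycleSpectrum.
Variables (m : nat) (F Rg : 'I_m -> {set T}).
Hypothesis m3 : (3 <= m)%N.
Hypotheses (Finj : injective F) (FE : [set F i | i : 'I_m] = facets K).
Hypotheses (Rinj : injective Rg) (RE : forall i, Rg i = F i :&: F (ordS i)).
Hypothesis atE : forall i, facets_at K (Rg i) = [set F i; F (ordS i)].
Hypothesis RN : [set Rg i | i : 'I_m] = nonfree.

Let m0 : (0 < m)%N. Proof. exact: leq_trans m3. Qed.

(* Facets and ridges are indexed by nat, modulo m.  This turns cyclic identities
   into recurrences that hold for all k, with periodicity stated apart. *)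
Let idx k : 'I_m := Ordinal (ltn_pmod k m0).
Let f k := F (idx k).
Let r k := Rg (idx k).

Let idxS k : ordS (idx k) = idx k.+1.
Proof. by apply/val_inj; rewrite /= -addn1 modnDml addn1. Qed.

Let idxD k : idx (k + m) = idx k.
Proof. by apply/val_inj; rewrite /= modnDr. Qed.

Let f_facet k : f k \in facets K.
Proof. by rewrite -FE imset_f. Qed.

Let r_nonfree k : r k \in nonfree.
Proof. by rewrite -RN imset_f. Qed.

Let r_ridge k : r k \in ridges K d.
Proof. exact: nonfree_ridge. Qed.

Let rE k : r k = f k :&: f k.+1.
Proof. by rewrite /r RE idxS. Qed.

Let rf k : r k \subset f k.
Proof. by rewrite rE subsetIl. Qed.

Let rfS k : r k \subset f k.+1.
Proof. by rewrite rE subsetIr. Qed.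

Let at_r k : facets_at K (r k) = [set f k; f k.+1].
Proof. by rewrite /r atE idxS. Qed.

Let fS_neq k : f k.+1 != f k.
Proof. by rewrite (inj_eq Finj) -idxS ordS_neq // ltnW. Qed.

Let rS_neq k : r k.+1 != r k.
Proof. by rewrite (inj_eq Rinj) -idxS ordS_neq // ltnW. Qed.

Definition edge_sign k : Real := inc (r k) (f k) * inc (r k) (f k.+1).

(** The change of signs that makes the sign between consecutive facets 1, except
    that going around once multiplies it by [walk_sign m]. *)
Definition walk_sign k : Real := \prod_(j < k) edge_sign j.

Let edge_sqr k : edge_sign k * edge_sign k = 1.
Proof. by rewrite /edge_sign mulrACA !inc_sqr // mulr1. Qed.

Let walkS k : walk_sign k.+1 = walk_sign k * edge_sign k.
Proof. by rewrite /walk_sign big_ord_recr. Qed.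

Let walk_sqr k : walk_sign k * walk_sign k = 1.
Proof.
elim: k => [|k IH]; first by rewrite /walk_sign big_ord0 mulr1.
by rewrite walkS mulrACA IH edge_sqr mulr1.
Qed.

Let walkD k : walk_sign (k + m) = walk_sign k * walk_sign m.
Proof.
elim: k => [|k IH]; first by rewrite {2}/walk_sign big_ord0 mul1r.
rewrite addSn !walkS IH mulrAC; congr (_ * _ * _).
by rewrite /edge_sign /r /f -addSn !idxD.
Qed.

Let nonfree_f k : nonfree_in (f k.+1) = [set r k; r k.+1].
Proof.
apply/setP => R; rewrite in_set in_set2; apply/andP/orP.
  rewrite -RN => -[/imsetP[i _ ->] Rf].
  have : f k.+1 \in facets_at K (Rg i) by rewrite in_set f_facet.
  rewrite atE in_set2 !(inj_eq Finj) => /orP[/eqP<-|/eqP ki]; first by right.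
  left; apply/eqP; congr Rg; apply/esym/(can_inj (@ordSK _)).
  by rewrite -ki idxS.
by case=> /eqP->; split.
Qed.

Lemma down_laplacian_cycle y k : down_laplacian y (f k.+1) =
  d.+1%:R * y (f k.+1) + edge_sign k * y (f k) + edge_sign k.+1 * y (f k.+2).
Proof.
rewrite down_laplacianE // nonfree_f -addrA; congr (_ + _).
rewrite big_setU1 ?in_set1 1?eq_sym ?rS_neq //= big_set1.
have -> : facets_at K (r k) :\ f k.+1 = [set f k].
  by rewrite at_r setUC setU1K // in_set1 fS_neq.
have -> : facets_at K (r k.+1) :\ f k.+1 = [set f k.+2].
  by rewrite at_r setU1K // in_set1 eq_sym fS_neq.
by rewrite !big_set1 /edge_sign !mulrA [X in X * y (f k)]mulrC.
Qed.

(** [F] is injective, so the sum has one term: the value of [c] at the index of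
    the facet, with the change of signs. *)
Definition twisted (c : nat -> Real) G : Real :=
  \sum_(i < m | F i == G) walk_sign i * c i.

(** The sequence [c] must pick up the same factor as [walk_sign] over a period
    for the formula to hold beyond the first period. *)
Lemma twistedE c k : (forall l, c (l + m)%N = walk_sign m * c l) ->
  twisted c (f k) = walk_sign k * c k.
Proof.
move=> cD; rewrite /twisted (big_pred1 (idx k)) => [|i]; last by rewrite /= (inj_eq Finj).
rewrite /= [in RHS](divn_eq k m) addnC; elim: (k %/ m)%N => [|q IH].
  by rewrite mul0n addn0.
rewrite mulSn [(m + _)%N]addnC addnA walkD cD mulrA.
by rewrite -[_ * walk_sign m * walk_sign m]mulrA walk_sqr mulr1.
Qed.

Lemma twisted_eigen c mu : (forall l, c (l + m)%N = walk_sign m * c l) ->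
    (forall l, c l + c l.+2 = mu * c l.+1) ->
  forall G, G \in facets K -> down_laplacian (twisted c) G = (d.+1%:R + mu) * twisted c G.
Proof.
move=> cD cS G; rewrite -FE => /imsetP[i _ ->].
(* a successor index, to which down_laplacian_cycle applies *)
have -> : F i = f (i + m.-1).+1.
  congr F; apply/val_inj; rewrite /= -addnS prednK // modnDr modn_small //.
move: (i + m.-1)%N => k; rewrite down_laplacian_cycle !twistedE // !walkS.
rewrite mulrDl -addrA; congr (_ + _).
rewrite [mu * _]mulrCA -cS mulrDr; congr (_ + _).
  by rewrite mulrA; congr (_ * _); rewrite mulrC.
transitivity (walk_sign k * edge_sign k * c k.+2 *
  (edge_sign k.+1 * edge_sign k.+1)); first by ring.
by rewrite edge_sqr mulr1.
Qed.

(** The sum formulas give c_k + c_(k+2) = 2 cos phi c_(k+1) for both cos (k phi)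
    and sin (k phi); the values at 0 and phi show that these are independent. *)
Lemma multiplicity_angle (phi : Real) :
    trigo.cos (m%:R * phi) = walk_sign m -> trigo.sin (m%:R * phi) = 0 ->
    trigo.sin phi != 0 -> 0 <= trigo.cos phi ->
  (2 <= multiplicity o K d (d.+1%:R + 2 * trigo.cos phi))%N.
Proof.
move=> cosm sinm sin0 cos0.
pose C k : Real := trigo.cos (k%:R * phi); pose S k : Real := trigo.sin (k%:R * phi).
have CD l : C (l + m)%N = walk_sign m * C l.
  by rewrite /C natrD mulrDl trigo.cosD cosm sinm mulr0 subr0 mulrC.
have SD l : S (l + m)%N = walk_sign m * S l.
  by rewrite /S natrD mulrDl trigo.sinD cosm sinm mulr0 addr0 mulrC.
have before l : l%:R * phi = l.+1%:R * phi - phi by rewrite -[l.+1%:R]natr1; ring.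
have after l : l.+2%:R * phi = l.+1%:R * phi + phi by rewrite -[l.+2%:R]natr1; ring.
have CS l : C l + C l.+2 = 2 * trigo.cos phi * C l.+1.
  by rewrite /C (before l) (after l) trigo.cosB trigo.cosD; ring.
have SS l : S l + S l.+2 = 2 * trigo.cos phi * S l.+1.
  by rewrite /S (before l) (after l) trigo.sinB trigo.sinD; ring.
have d0 : 0 <= d.+1%:R :> Real by exact: ler0n.
apply: (multiplicity_ge (y := fun i : 'I_2 => if i == 0 then twisted C else twisted S)).
- by rewrite gt_eqF // ltr_wpDr ?mulr_ge0 ?ltr0n.
- by move=> i; case: eqP => _; exact: twisted_eigen.
- move=> c c0.
  have c00 : c ord0 = 0.
    have := c0 _ (f_facet 0); rewrite !big_ord_recl big_ord0 /= !twistedE //.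
    rewrite /C /S mul0r trigo.cos0 trigo.sin0 /walk_sign big_ord0.
    by rewrite !mulr0 !mulr1 !addr0.
  have c01 : c (lift ord0 ord0) = 0.
    have := c0 _ (f_facet 1); rewrite !big_ord_recl big_ord0 /= !twistedE //.
    rewrite c00 mul0r add0r addr0 /S mul1r => /eqP.
    rewrite !mulf_eq0 (negPf sin0) orbF => /orP[/eqP//|/eqP s0].
    by have /eqP := walk_sqr 1; rewrite s0 mulr0 eq_sym oner_eq0.
  by move=> i; case: (unliftP ord0 i) => [j ->|->] //; rewrite (ord1 j).
Qed.

Lemma walk_sign3 : m = 3%N -> walk_sign m = -1.
Proof.
move=> m3E; have f3 : f 3 = f 0 by rewrite /f -[3%N]add0n -m3E idxD.
rewrite m3E /walk_sign !big_ord_recl big_ord0 /= mulr1 mulrA /edge_sign.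
have r2 : r 2 = f 2 :&: f 0 by rewrite rE f3.
have neq k l : (k < l < 3)%N -> r k != r l.
  move=> kl; rewrite (inj_eq Rinj); apply/eqP => /(congr1 val) /=.
  by rewrite m3E !modn_small; lia.
have inK k : f k \in K by exact: facet_face.
have cf k : #|f k| = d.+1 by exact: hpure.
have cr k : #|r k| = d by exact: card_ridge.
have rK k : r k \in K by exact: ridge_face.
have := @incidence_three_cycle T Real o K d ho (f 0) (f 1) (f 2).
rewrite /bump /= !addn0 !add1n f3 -r2 -!rE; apply=> //; exact: neq.
Qed.

(** The angle is chosen in the interval from 0 to pi / 2, so that cos phi >= 0
    keeps the eigenvalue above d and sin phi > 0.  With sign 1 around the cycle
    the angle is 2 pi / m, and 2 pi / m <= pi / 2 requires m >= 4. *)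
Lemma cycle_multiplicity : exists lam : Real,
  [/\ 0 < lam, lam != d%:R & (2 <= multiplicity o K d lam)%N].
Proof.
have mR : m%:R != 0 :> Real by rewrite pnatr_eq0 -lt0n.
have pi0 := trigo.pi_gt0 Real.
have angle phi : 0 < phi <= trigo.pi / 2 ->
    trigo.cos (m%:R * phi) = walk_sign m -> trigo.sin (m%:R * phi) = 0 ->
    exists lam : Real,
      [/\ 0 < lam, lam != d%:R & (2 <= multiplicity o K d lam)%N].
  case/andP=> phi0 phi2 cosm sinm.
  have cos0 : 0 <= trigo.cos phi by apply: trigo.cos_ge0_pihalf; lra.
  have sin0 : 0 < trigo.sin phi by apply: trigo.sin_gt0_pi; lra.
  have d0 : 0 <= d%:R :> Real by exact: ler0n.
  exists (d.+1%:R + 2 * trigo.cos phi); split.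
  - by rewrite -natr1; lra.
  - by rewrite -natr1 gt_eqF //; lra.
  - by apply: multiplicity_angle => //; rewrite gt_eqF.
have /eqP : walk_sign m * walk_sign m = 1 by exact: walk_sqr.
rewrite -expr2 sqrf_eq1 => /orP[] /eqP E.
- have m4 : (4 <= m)%N.
    rewrite ltn_neqAle m3 andbT; apply/eqP => m3E.
    by have := walk_sign3 (esym m3E); rewrite E; lra.
  have m4R : 4 <= m%:R :> Real by rewrite (ler_nat _ 4).
  apply: (angle (trigo.pi *+ 2 / m%:R)).
  + by apply/andP; split; [rewrite divr_gt0 ?ltr0n //; lra|rewrite ler_pdivrMr ?ltr0n //; nra].
  + by rewrite mulrC divfK // trigo.cos2pi E.
  + by rewrite mulrC divfK // trigo.sin2pi.
- have m3R : 3 <= m%:R :> Real by rewrite (ler_nat _ 3).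
  apply: (angle (trigo.pi / m%:R)).
  + by apply/andP; split; [rewrite divr_gt0 ?ltr0n|rewrite ler_pdivrMr ?ltr0n //; nra].
  + by rewrite mulrC divfK // trigo.cospi E.
  + by rewrite mulrC divfK // trigo.sinpi.
Qed.

End CycleSpectrum.

(** * The bounds and the case of equality *)

Lemma multiplicity_bound (lam : Real) : 0 < lam -> lam != d%:R ->
  (multiplicity o K d lam)%:Z <= 2 * theta K d + #|quasi|%:Z.
Proof.
move=> lam0 lamd; have [S SC cS] := core_forcing.
by apply: le_trans cS; rewrite lez_nat; apply: multiplicity_le.
Qed.

Lemma multiplicity_bound_strict (lam : Real) :
    #|core| != 1%N -> (theta K d, #|pendant_facets K d|) <> (1, 0%N) ->
    0 < lam -> lam != d%:R ->
  (multiplicity o K d lam)%:Z <= 2 * theta K d + #|quasi|%:Z - 1.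
Proof.
move=> c1 tp lam0 lamd; have [S SC cS] := core_forcing_strict c1 tp.
by apply: le_trans cS; rewrite lez_nat; apply: multiplicity_le.
Qed.

(** Equality follows from inequalities only: for a ridge-star with n = 1 and for
    a simplicial cycle with n = 2, the bound is at most n. *)
Lemma multiplicity_attained (lam : Real) (n : nat) : (0 < n)%N -> 0 < lam -> lam != d%:R ->
    (n <= multiplicity o K d lam)%N -> 2 * theta K d + #|quasi|%:Z <= n%:Z ->
  [/\ eigenvalue (ridge_laplacian Real o K d) lam, 0 < lam, lam != d%:R
    & (multiplicity o K d lam)%:Z = 2 * theta K d + #|quasi|%:Z].
Proof.
move=> n0 lam0 lamd le_n bound; split=> //.
  exact: eigenvalue_multiplicity (leq_trans n0 le_n).
apply/eqP; rewrite eq_le multiplicity_bound //=.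
by apply: le_trans bound _; rewrite lez_nat.
Qed.

Lemma cycle_eigenvalue : simplicial_cycle K d -> exists lam : Real,
  [/\ 0 < lam, lam != d%:R & (2 <= multiplicity o K d lam)%N].
Proof.
case=> _ _ [m [F [Rg [m3 [Finj FE] [Rinj _] [RE atE RN]]]]].
exact: cycle_multiplicity m3 Finj FE Rinj RE atE RN.
Qed.

Lemma bound_attained_iff :
  (exists lam : Real,
    [/\ eigenvalue (ridge_laplacian Real o K d) lam, 0 < lam, lam != d%:R
      & (multiplicity o K d lam)%:Z = 2 * theta K d + #|quasi|%:Z])
  <-> (ridge_star K d \/ simplicial_cycle K d).
Proof.
split=> [[lam [_ lam0 lamd attained]]|[star|cyc]].
- have [/single_core_star|core1] := eqVneq #|core| 1%N; first by left.
  have [[th p0]|/eqP tp] := eqVneq (theta K d, #|pendant_facets K d|) (1, 0%N).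
    by right; apply: unicyclic_cycle.
  have := multiplicity_bound_strict core1 tp lam0 lamd.
  by rewrite attained lerBrDr gerDl.
- have f0 : (0 < #|facets K|)%N by exact: ltnW.
  exists (d + #|facets K|)%:R; apply: (multiplicity_attained (ltn0Sn 0)).
  + by rewrite ltr0n addn_gt0 hd.
  + by rewrite eqr_nat -[X in _ != X]addn0 eqn_add2l -lt0n.
  + exact: star_eigenvalue.
  + exact: star_bound.
- have [lam [lam0 lamd mult2]] := cycle_eigenvalue cyc; exists lam.
  by apply: (multiplicity_attained (ltn0Sn 1)) => //; apply: cycle_bound.
Qed.

End Spectrum.
End FacetRidgeGraph.

Theorem theorem4 (R : realType) (T : finType) (K : {set {set T}})
    (o : {set T} -> seq T) (d : nat)
    (hd : (1 <= d)%N)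
    (hK : simplicial_complex K) (ho : orientation K o)
    (hpure : pure K d) (hconn : ridge_connected K d)
    (h2 : (2 <= #|facets K|)%N) :
  [/\ forall lam : R,
        eigenvalue (ridge_laplacian R o K d) lam -> 0 < lam -> lam != d%:R ->
        (multiplicity o K d lam)%:Z
          <= 2 * theta K d + #|quasi_pendant_ridges K d|%:Z,
      ~ ridge_star K d ->
      (theta K d, #|pendant_facets K d|) <> (1, 0%N) ->
      forall lam : R,
        eigenvalue (ridge_laplacian R o K d) lam -> 0 < lam -> lam != d%:R ->
        (multiplicity o K d lam)%:Z
          <= 2 * theta K d + #|quasi_pendant_ridges K d|%:Z - 1
    & (exists lam : R,
        [/\ eigenvalue (ridge_laplacian R o K d) lam, 0 < lam, lam != d%:R
          & (multiplicity o K d lam)%:Z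
              = 2 * theta K d + #|quasi_pendant_ridges K d|%:Z])
      <-> (ridge_star K d \/ simplicial_cycle K d)].
Proof.
split.
- by move=> lam _ lam0 lamd; apply: multiplicity_bound.
- move=> nstar tp lam _ lam0 lamd; apply: multiplicity_bound_strict => //.
  by apply/eqP => core1; apply: nstar; apply: single_core_star.
- exact: bound_attained_iff.
Qed.
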